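(* Suppose the fusion bialgebra $(\mathcal{A},\mathcal{B},\mathfrak{F},d,\tau)$ can be subfactorized. Then the Schur product property holds on the dual, i.e. $x*_{\mathcal{B}}y\ge0$ in $\mathcal{B}$ for all $x,y\ge0$ in $\mathcal{B}$.
   Context: Fusion bialgebra: let $\mathcal{A}$ and $\mathcal{B}$ be finite-dimensional $C^*$-algebras with faithful (positive, not necessarily normalized) traces $d$ and $\tau$ respectively, with $\mathcal{A}$ commutative. The multiplication and involution of $\mathcal{A}$ are written $\diamond$ and $\#$, those of $\mathcal{B}$ are written $xy$ and $*$. Let $\mathfrak{F}:\mathcal{A}\to\mathcal{B}$ be a linear bijection with $\tau(\mathfrak{F}(x)^*\mathfrak{F}(y))=d(x^\#\diamond y)$ for all $x,y\in\mathcal{A}$. The quintuple $(\mathcal{A},\mathcal{B},\mathfrak{F},d,\tau)$ is a fusion bialgebra if: (1) for $x,y\ge0$ in $\mathcal{A}$, $x*y:=\mathfrak{F}^{-1}(\mathfrak{F}(x)\mathfrak{F}(y))\ge0$ in $\mathcal{A}$; (2) $J(x):=\mathfrak{F}^{-1}(\mathfrak{F}(x)^* )$ is an anti-linear $*$-isomorphism of $\mathcal{A}$; (3) $\mathfrak{F}^{-1}(1_{\mathcal{B}})$ is a positive multiple of a minimal projection of $\mathcal{A}$. Convolution on $\mathcal{B}$: $x*_{\mathcal{B}}y:=\big(\mathfrak{F}(\mathfrak{F}^{-1}(y^* )\diamond\mathfrak{F}^{-1}(x^* ))\big)^*$ for $x,y\in\mathcal{B}$. Subfactorization: for a finite-index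 subfactor $\mathcal{N}\subset\mathcal{M}$ (of II$_1$ factors) with index $\delta^2$, Jones tower $\mathcal{N}\subset\mathcal{M}\subset\mathcal{M}_1\subset\mathcal{M}_2$, and Jones projections $e_1\in\mathcal{M}_1$, $e_2\in\mathcal{M}_2$, put $\mathscr{P}_{2,+}=\mathcal{N}'\cap\mathcal{M}_1$, $\mathscr{P}_{2,-}=\mathcal{M}'\cap\mathcal{M}_2$, with restricted normalized traces $tr_{2,\pm}$, and let $\mathfrak{F}_s:\mathscr{P}_{2,+}\to\mathscr{P}_{2,-}$ be the string Fourier transform ($90^\circ$ rotation), $\mathfrak{F}_s(x)=\delta^3E(xe_2e_1)$ with $E$ the trace-preserving conditional expectation of $\mathcal{N}'\cap\mathcal{M}_2$ onto $\mathcal{M}'\cap\mathcal{M}_2$. If $\mathscr{P}_{2,+}$ is abelian, $(\mathscr{P}_{2,+},\mathscr{P}_{2,-},\mathfrak{F}_s,tr_{2,+},tr_{2,-})$ is a fusion bialgebra. A fusion bialgebra can be subfactorized if it comes from a subfactor in this way (up to isomorphism, i.e. $*$-isomorphisms of $\mathcal{A}$ and $\mathcal{B}$ intertwining all the structure, and gauge transformation $(\mathfrak{F},d,\tau)\mapsto(\lambda_1^{1/2}\lambda_2^{-1/2}\mathfrak{F},\lambda_1d,\lambda_2\tau)$, $\lambda_1,\lambda_2>0$). *)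

(* Defs.v *)
From HB Require Import structures.
From mathcomp Require Import all_boot all_order all_algebra all_field.
From mathcomp Require Import all_classical all_reals all_analysis.
From mathcomp Require Import complex.

Set Implicit Arguments.
Unset Strict Implicit.
Unset Printing Implicit Defensive.

Import Order.TTheory GRing.Theory Num.Theory Num.Def.
Import numFieldNormedType.Exports.

Local Open Scope ring_scope.
Local Open Scope complex_scope.
Local Open Scope classical_set_scope.

(* Throughout, R : realType and the complex numbers are R[i].  The order of   *)
(* R[i] is the partial one: 0 <= z means that z is real and nonnegative.      *)

(* Norms take values in R[i], as everywhere in MathComp.  Completeness is     *)
(* automatic in finite dimension.                                             *)
Record fdCstarAlg (R : realType) := FdCstarAlg {
  fdalg :> falgType R[i];
  star : fdalg -> fdalg;
  star_antilinear : forall (c : R[i]) x y,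
    star (c *: x + y) = c^* *: star x + star y;
  starK : involutive star;
  starM : forall x y, star (x * y) = star y * star x;
  cstar_norm : exists nrm : fdalg -> R[i],
    [/\ forall x, 0 <= nrm x /\ (nrm x = 0 -> x = 0),
        forall x y, nrm (x + y) <= nrm x + nrm y,
        forall (c : R[i]) x, nrm (c *: x) = `|c| * nrm x,
        forall x y, nrm (x * y) <= nrm x * nrm y
      & forall x, nrm (star x * x) = nrm x ^+ 2] }.

Definition cpositive (R : realType) (A : fdCstarAlg R) (x : A) : Prop :=
  exists a : A, x = star a * a.

Definition faithful_trace (R : realType) (A : fdCstarAlg R)
    (t : {scalar A}) : Prop :=
  [/\ forall x y, t (x * y) = t (y * x),
      forall x, 0 <= t (star x * x)
    & forall x, t (star x * x) = 0 -> x = 0].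

Definition projection (R : realType) (A : fdCstarAlg R) (p : A) : Prop :=
  star p = p /\ p * p = p.

Definition minimal_projection (R : realType) (A : fdCstarAlg R) (p : A) : Prop :=
  [/\ projection p, p != 0 &
      forall q : A, projection q -> p * q = q -> q * p = q -> q = 0 \/ q = p].

(* [Finv] is the inverse of the linear bijection [F].                         *)
Definition convA (R : realType) (A B : fdCstarAlg R)
    (F : A -> B) (Finv : B -> A) (x y : A) : A := Finv (F x * F y).

Definition fbJ (R : realType) (A B : fdCstarAlg R)
    (F : A -> B) (Finv : B -> A) (x : A) : A := Finv (star (F x)).

Definition convB (R : realType) (A B : fdCstarAlg R)
    (F : A -> B) (Finv : B -> A) (x y : B) : B :=
  star (F (Finv (star y) * Finv (star x))).

Record fusion_bialgebra (R : realType) (A B : fdCstarAlg R)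
    (F : {linear A -> B}) (Finv : B -> A) (d : {scalar A}) (tau : {scalar B}) :
    Prop := {
  fb_comm : forall x y : A, x * y = y * x;
  fb_d : faithful_trace d;
  fb_tau : faithful_trace tau;
  fb_FK : cancel F Finv;
  fb_FinvK : cancel Finv F;
  fb_plancherel : forall x y : A, tau (star (F x) * F y) = d (star x * y);
  fb_schur : forall x y : A,
    cpositive x -> cpositive y -> cpositive (convA F Finv x y);
  fb_J_antilinear : forall (c : R[i]) (x y : A),
    fbJ F Finv (c *: x + y) = c^* *: fbJ F Finv x + fbJ F Finv y;
  fb_J_mul : forall x y : A, fbJ F Finv (x * y) = fbJ F Finv x * fbJ F Finv y;
  fb_J_star : forall x : A, fbJ F Finv (star x) = star (fbJ F Finv x);
  fb_J_bij : bijective (fbJ F Finv);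
  fb_unit : exists (c : R) (p : A),
    [/\ 0 < c, minimal_projection p & Finv 1 = c%:C *: p] }.

Record hilbertSpace (R : realType) := HilbertSpace {
  hspace :> completeNormedModType R[i];
  ip : {dot hspace for conjC};
  ip_norm : forall v : hspace, `|v| ^+ 2 = ip v v }.

Section Operators.
Context {R : realType} {H : hilbertSpace R}.
Implicit Types (S T : H -> H) (M : set (H -> H)).

Definition adjoint S T : Prop := forall u v : H, ip H (S u) v = ip H u (T v).

Definition bounded_op : set (H -> H) := [set T | linear T /\ continuous T].

Definition commutant M : set (H -> H) :=
  [set T | bounded_op T /\ forall S, M S -> T \o S = S \o T].

(* By the bicommutant theorem this is the usual notion; such an M is          *)
(* automatically a unital algebra of bounded operators.                       *)
Definition von_neumann M : Prop :=
  (forall S, M S -> exists2 T, M T & adjoint S T) /\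
  commutant (commutant M) = M.

Definition factor M : Prop :=
  von_neumann M /\
  (forall T, M T -> commutant M T -> exists c : R[i], T = (fun v => c *: v)).

Definition infinite_dimensional M : Prop :=
  ~ exists (n : nat) (b : 'I_n -> H -> H), forall T, M T ->
      exists c : 'I_n -> R[i], T = (fun v => \sum_(i < n) c i *: b i v).

(* The ultraweakly continuous functionals are exactly those of this form.     *)
Definition ultraweakly_continuous M (t : (H -> H) -> R[i]) : Prop :=
  exists xi eta : nat -> H,
    [/\ cvgn (series (fun n => `|xi n| ^+ 2 : R[i]^o)),
        cvgn (series (fun n => `|eta n| ^+ 2 : R[i]^o))
      & forall T, M T ->
          series (fun n => ip H (T (xi n)) (eta n) : R[i]^o) @ \oo
            --> (t T : R[i]^o)].

(* Only the values of t on M matter.                                          *)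
Record normalized_trace M (t : (H -> H) -> R[i]) : Prop := {
  ntr_linear : forall (c : R[i]) S T, M S -> M T ->
    t (fun v => c *: S v + T v) = c * t S + t T;
  ntr_id : t id = 1;
  ntr_comm : forall S T, M S -> M T -> t (S \o T) = t (T \o S);
  ntr_pos : forall S T, M S -> M T -> adjoint S T -> 0 <= t (T \o S);
  ntr_faithful : forall S T, M S -> M T -> adjoint S T ->
    t (T \o S) = 0 -> S = (fun=> 0);
  ntr_normal : ultraweakly_continuous M t }.

Definition II1_factor M (t : (H -> H) -> R[i]) : Prop :=
  [/\ factor M, infinite_dimensional M & normalized_trace M t].

(* P is the orthogonal projection onto the closed subspace E.                 *)
Definition orthogonal_projection (E : set H) (P : H -> H) : Prop :=
  forall v : H, E (P v) /\ forall w : H, E w -> ip H (v - P v) w = 0.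

Definition cyclic_subspace M (xi : H) : set H :=
  closure [set T xi | T in M].

(* E is the t-preserving conditional expectation of P onto Q.                 *)
Record conditional_expectation (P Q : set (H -> H)) (t : (H -> H) -> R[i])
    (E : (H -> H) -> (H -> H)) : Prop := {
  ce_range : forall x, P x -> Q (E x);
  ce_id : forall q, Q q -> E q = q;
  ce_linear : forall (c : R[i]) x y, P x -> P y ->
    E (fun v => c *: x v + y v) = (fun v => c *: E x v + E y v);
  ce_pos : forall x, P x -> (forall v, 0 <= ip H (x v) v) ->
    forall v, 0 <= ip H (E x v) v;
  ce_bimodule : forall p q x, Q p -> Q q -> P x ->
    E (p \o x \o q) = p \o E x \o q;
  ce_trace : forall x, P x -> t (E x) = t x }.

End Operators.

(* rho restricts to a *-isomorphism of the von Neumann algebra M on H onto a   *)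
(* von Neumann algebra on K.                                                  *)
Record vn_isomorphism (R : realType) (H K : hilbertSpace R)
    (M : set (H -> H)) (rho : (H -> H) -> (K -> K)) : Prop := {
  vni_linear : forall (c : R[i]) S T, M S -> M T ->
    rho (fun v => c *: S v + T v) = (fun v => c *: rho S v + rho T v);
  vni_mul : forall S T, M S -> M T -> rho (S \o T) = rho S \o rho T;
  vni_id : rho id = id;
  vni_star : forall S T, M S -> M T -> adjoint S T -> adjoint (rho S) (rho T);
  vni_inj : forall S T, M S -> M T -> rho S = rho T -> S = T;
  vni_range : von_neumann (rho @` M) }.

(* (K, rho, Om) is the GNS construction L^2(M, t) of M with respect to t.      *)
Record gns (R : realType) (H K : hilbertSpace R) (M : set (H -> H))
    (t : (H -> H) -> R[i]) (rho : (H -> H) -> (K -> K)) (Om : K) : Prop := {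
  gns_iso : vn_isomorphism M rho;
  gns_state : forall T, M T -> ip K (rho T Om) Om = t T;
  gns_cyclic : cyclic_subspace (rho @` M) Om = setT }.

(* M `<=` M1 and e : M1 are, up to isomorphism, the basic construction of     *)
(* N `<=` M: on L^2(M, t), e is the projection onto the closure L^2(N, t) of  *)
(* N, and M1 is the von Neumann algebra generated by M and e.                 *)
Definition basic_construction (R : realType) (H : hilbertSpace R)
    (N M M1 : set (H -> H)) (e : H -> H) (t : (H -> H) -> R[i]) : Prop :=
  [/\ M `<=` M1, M1 e &
   exists (K : hilbertSpace R) (rho : (H -> H) -> (K -> K)) (Om : K),
    [/\ vn_isomorphism M1 rho,
        gns M t rho Om,
        orthogonal_projection (cyclic_subspace (rho @` N) Om) (rho e)
      & rho @` M1 = commutant (commutant (rho @` M `|` [set rho e]))]].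

(* The Jones index [M : N] is dim_N L^2(M, t), where the Murray-von Neumann   *)
(* dimension dim_N K is t [N' xi] / t' [N xi], t' being the normalized trace  *)
(* of the commutant N' on K (a II_1 factor exactly when the index is finite); *)
(* this ratio does not depend on the nonzero vector xi.                       *)
Definition jones_index (R : realType) (H : hilbertSpace R)
    (N M : set (H -> H)) (t : (H -> H) -> R[i]) (ind : R) : Prop :=
  exists (K : hilbertSpace R) (rho : (H -> H) -> (K -> K)) (Om : K)
         (t' : (K -> K) -> R[i]) (xi : K) (p : H -> H) (q : K -> K),
    let N' := commutant (rho @` N) in
    [/\ gns M t rho Om,
        II1_factor N' t',
        xi != 0,
        N p /\ orthogonal_projection (cyclic_subspace N' xi) (rho p)
      & orthogonal_projection (cyclic_subspace (rho @` N) xi) q /\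
        t p = ind%:C * t' q].

(* The tower is realised on the Hilbert space H of M2; by uniqueness the      *)
(* normalized trace of each smaller factor is the restriction of that of M2.  *)
Record jones_tower (R : realType) (H : hilbertSpace R)
    (N M M1 M2 : set (H -> H)) (e1 e2 : H -> H) (t : (H -> H) -> R[i])
    (delta : R) : Prop := {
  jt_N : II1_factor N t;
  jt_M : II1_factor M t;
  jt_M1 : II1_factor M1 t;
  jt_M2 : II1_factor M2 t;
  jt_NM : N `<=` M;
  jt_basic1 : basic_construction N M M1 e1 t;
  jt_basic2 : basic_construction M M1 M2 e2 t;
  jt_delta : 0 < delta;
  jt_index : jones_index N M t (delta ^+ 2) }.

Definition relcomm (R : realType) (H : hilbertSpace R) (N M : set (H -> H)) :
  set (H -> H) := commutant N `&` M.

Definition string_fourier (R : realType) (H : hilbertSpace R) (delta : R)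
    (E : (H -> H) -> (H -> H)) (e1 e2 x : H -> H) : H -> H :=
  fun v => (delta ^+ 3)%:C *: E (x \o e2 \o e1) v.

(* phi is a *-isomorphism of A onto the *-algebra P of operators.             *)
Record star_isomorphism (R : realType) (A : fdCstarAlg R) (H : hilbertSpace R)
    (P : set (H -> H)) (phi : A -> (H -> H)) : Prop := {
  si_linear : forall (c : R[i]) (x y : A),
    phi (c *: x + y) = (fun v => c *: phi x v + phi y v);
  si_mul : forall x y : A, phi (x * y) = phi x \o phi y;
  si_one : phi 1 = id;
  si_star : forall x : A, adjoint (phi x) (phi (star x));
  si_inj : injective phi;
  si_range : range phi = P }.

(* Some gauge transform                                                       *)
(*   (l1^(1/2) l2^(-1/2) F, l1 d, l2 tau)                                     *)
(* of (F, d, tau) is isomorphic, by phi and psi, to the fusion bialgebra of a *)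
(* finite-index II_1 subfactor.                                               *)
Definition subfactorizable (R : realType) (A B : fdCstarAlg R)
    (F : {linear A -> B}) (d : {scalar A}) (tau : {scalar B}) : Prop :=
  exists (H : hilbertSpace R) (N M M1 M2 : set (H -> H)) (e1 e2 : H -> H)
         (t : (H -> H) -> R[i]) (delta : R) (E : (H -> H) -> (H -> H)),
    let P2p := relcomm N M1 in
    let P2m := relcomm M M2 in
    [/\ jones_tower N M M1 M2 e1 e2 t delta,
        conditional_expectation (relcomm N M2) P2m t E,
        forall x y, P2p x -> P2p y -> x \o y = y \o x
      & exists (l1 l2 : R) (phi : A -> (H -> H)) (psi : B -> (H -> H)),
        [/\ 0 < l1 /\ 0 < l2,
            star_isomorphism P2p phi,
            star_isomorphism P2m psi,
            forall x : A, psi ((Num.sqrt l1 / Num.sqrt l2)%:C *: F x) =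
                          string_fourier delta E e1 e2 (phi x)
          & (forall x : A, t (phi x) = l1%:C * d x) /\
            (forall y : B, t (psi y) = l2%:C * tau y)]].

(* Main.v *)
(* The inverse transforms a of positive elements of M' /\ M2 act on L^2(M)
   as completely positive maps, so the Schur product property on the dual says
   that such maps compose.  Concretely, with q the adjoint of the transform of
   b^*, one has for s, r in the span of M e1 M and Om the trace vector of M1
     < F_s(ab) s Om, r Om > = delta t(r^* F_s(a) s q),
   which is visibly nonnegative for r = s when F_s(a) and q are.  The vectors
   s Om are dense in L^2(M1): the projection onto their closure lies in
   M' /\ M2, on which e1 Om is a faithful trace vector.
     The identity rests on F_s(x) e1 = delta x e2 e1.  This is obtained without
   Pimsner-Popa bases: F_s is a surjective isometry for the trace norms (part
   of the fusion bialgebra structure), which forces t(e1) = t(e2) = delta^-2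
   and makes the trace norm of the difference of the two sides vanish.
   Irreducibility of N in M follows from the commutativity of N' /\ M1, and
   the Markov property of e1, e2 from averaging over unitaries.
     In the fusion bialgebra, b |-> b^* transforms to a multiplicative
   star-preserving map of B because convolution preserves positive elements,
   so q is positive as well. *)
Require Import Defs.
From HB Require Import structures.
From mathcomp Require Import all_boot all_order all_algebra all_field.
From mathcomp Require Import all_classical all_reals all_analysis.
From mathcomp Require Import complex ring lra.

Set Implicit Arguments.
Unset Strict Implicit.
Unset Printing Implicit Defensive.

Import Order.TTheory GRing.Theory Num.Theory Num.Def.
Import numFieldNormedType.Exports.

Local Open Scope ring_scope.
Local Open Scope classical_set_scope.

(** * Real-valued norm and completeness *)

(** Averaging here means taking the vector of least norm in a closed convex set of vectors [y Om]. A
    uniform operator bound on the [y] makes this set closed: by traciality a limit of such vectors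
    comes from a strong limit of operators. The unitaries are Cayley transforms, so only the inverse
    of [1 - T] for skew-adjoint [T] is needed, and no spectral theorem. Write mu = t(e1), mu2 =
    t(e2). The preimage of 1 under F_s must be a multiple of e1, and its norm gives delta^6 mu2^2 mu
    = 1. The squared trace norms of F_s(1) - delta^3 mu e2 and of e1 e2 e1 - mu e1 are positive
    multiples of mu2 - mu and of mu - mu2, whence mu = mu2 = delta^-2 and e1 e2 e1 = mu e1. M2 is
    given on L^2(M1), where Om is a trace vector for M1 but in general not for M2. On M' /\ M2 the
    vector e1 Om takes this role, which yields the density and also turns t(w^* F_s(ab) w) into the
    value of a form at w e1 Om. Positivity in B asks for an actual factorization a^* a, so the trace
    inequalities must finally be converted into a square root. *)

Section RealNorm.
Context {R : realType}.
Implicit Types (c : R[i]).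

Definition rnorm c : R := complex.Re `|c|.

Lemma realcX (a : R) n : real_complex R (a ^+ n) = real_complex R a ^+ n.
Proof. exact: rmorphXn. Qed.
Lemma realcM (a b : R) : real_complex R (a * b) = real_complex R a * real_complex R b.
Proof. exact: rmorphM. Qed.
Lemma realcD (a b : R) : real_complex R (a + b) = real_complex R a + real_complex R b.
Proof. exact: rmorphD. Qed.
Lemma rnormE c : `|c| = real_complex R (rnorm c).
Proof. by rewrite /rnorm RRe_real // normr_real. Qed.
Lemma rnorm_ge0 c : 0 <= rnorm c.
Proof. by rewrite -ler0c -rnormE. Qed.
Lemma rnorm_eq0 c : rnorm c = 0 -> c = 0.
Proof. by move=> h; apply/eqP; rewrite -normr_eq0 rnormE h. Qed.
Lemma rnorm_half : rnorm (2^-1 : R[i]) = 2^-1.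
Proof.
have -> : (2^-1 : R[i]) = real_complex R 2^-1 by rewrite fmorphV rmorph_nat.
by apply: complexI; rewrite -rnormE ger0_norm // ler0c invr_ge0.
Qed.
End RealNorm.

(** The discriminant argument is detached from any particular form because it serves both the inner
    product and the trace pairing [t (S' \o T)]. *)
Lemma cauchy_schwarz_scalar (C : numClosedFieldType) (a b c : C) :
  0 <= a -> 0 <= b ->
  (forall l : C, 0 <= a + (l^* * c + l * c^*) + `|l| ^+ 2 * b) ->
  `|c| ^+ 2 <= a * b.
Proof.
move=> a0 b0 H; have [->|c0] := eqVneq c 0.
  by rewrite normr0 expr0n /= mulr_ge0.
have nc0 : 0 < `|c| ^+ 2 by rewrite exprn_gt0 ?normr_gt0.
have [b00|bn0] := eqVneq b 0.
  (* For [b = 0] the form is affine along the multiples of [c]; this [s] makes its value at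
     [- s * c] equal to -1. *)
  pose s : C := (a + 1) / (2 * `|c| ^+ 2).
  have s0 : 0 <= s by rewrite divr_ge0 ?mulr_ge0 ?addr_ge0 ?ler01 ?(ltW nc0) ?ler0n.
  have sc : s^* = s by apply/CrealP; rewrite ger0_real.
  have := H (- s * c); rewrite b00 mulr0 addr0 rmorphM rmorphN /= sc.
  have -> : a + (- s * c^* * c + - s * c * c^*) = - 1.
    rewrite -!mulrA [c^* * c]mulrC -normCK /s.
    have n0 : `|c| ^+ 2 != 0 by rewrite gt_eqF.
    by field; move: n0; rewrite expf_eq0.
  by rewrite oppr_ge0 ler10.
have bp : 0 < b by rewrite lt_def bn0 b0.
have := H (- c / b).
have bc : (b^-1)^* = b^-1 by apply/CrealP; rewrite rpredV ger0_real.
rewrite rmorphM rmorphN /= bc normrM normrN normfV exprMn (ger0_norm b0).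
have -> : a + (- c^* * b^-1 * c + - c / b * c^*) + `|c| ^+ 2 * b^-1 ^+ 2 * b
  = a - `|c| ^+ 2 / b by rewrite normCK; field.
by rewrite subr_ge0 ler_pdivrMr.
Qed.

(** * Inner products, bounded operators and closures in a Hilbert space *)

Section Hilbert.
Context {R : realType} {H : hilbertSpace R}.
Implicit Types (u v w x : H) (c : R[i]) (S T P : H -> H).

Lemma ipDl u v w : ip H (u + v) w = ip H u w + ip H v w.
Proof. by rewrite linearDl. Qed.
Lemma ipDr u v w : ip H u (v + w) = ip H u v + ip H u w.
Proof. by rewrite linearDr. Qed.
Lemma ipZl c u v : ip H (c *: u) v = c * ip H u v.
Proof. by rewrite linearZl_LR. Qed.
Lemma ipZr c u v : ip H u (c *: v) = c^* * ip H u v.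
Proof. by rewrite linearZr_LR. Qed.
Lemma ipBl u v w : ip H (u - v) w = ip H u w - ip H v w.
Proof. by rewrite linearBl. Qed.
Lemma ipBr u v w : ip H u (v - w) = ip H u v - ip H u w.
Proof. by rewrite linearBr. Qed.
Lemma ip0l v : ip H 0 v = 0.
Proof. by rewrite -(scale0r 0) ipZl mul0r. Qed.
Lemma ip0r v : ip H v 0 = 0.
Proof. by rewrite -(scale0r 0) ipZr rmorph0 mul0r. Qed.
Lemma ipC u v : ip H u v = (ip H v u)^*.
Proof. by rewrite hermC expr0 mul1r. Qed.
Lemma ip_ge0 v : 0 <= ip H v v.
Proof. by rewrite -ip_norm exprn_ge0. Qed.
Lemma ip_eq0 v : ip H v v = 0 -> v = 0.
Proof. by rewrite -ip_norm => /eqP; rewrite expf_eq0 /= normr_eq0 => /eqP. Qed.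

Lemma ip_ext u v : (forall w, ip H u w = ip H v w) -> u = v.
Proof.
move=> h; apply/eqP; rewrite -subr_eq0; apply/eqP/ip_eq0.
by rewrite ipBl h subrr.
Qed.

(** The norm of [H] takes values in [R[i]]; its real part gives access to infima and to real
    arithmetic. *)
Definition hn v : R := complex.Re `|v|.

Lemma hnE v : `|v| = real_complex R (hn v).
Proof. by rewrite /hn RRe_real // ger0_real. Qed.
Lemma hn_ge0 v : 0 <= hn v.
Proof. by rewrite -ler0c -hnE. Qed.
Lemma hn_eq0 v : hn v = 0 -> v = 0.
Proof. by move=> h; apply/eqP; rewrite -normr_eq0 hnE h. Qed.
Lemma hn0 : hn 0 = 0.
Proof. by rewrite /hn normr0. Qed.
Lemma ler_hnD u v : hn (u + v) <= hn u + hn v.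
Proof. by rewrite -lecR rmorphD /= -!hnE ler_normD. Qed.
Lemma hnN v : hn (- v) = hn v.
Proof. by rewrite /hn normrN. Qed.
Lemma hn_distC u v : hn (u - v) = hn (v - u).
Proof. by rewrite -opprB hnN. Qed.
Lemma ler_hn_dist v u w : hn (u - w) <= hn (u - v) + hn (v - w).
Proof. by rewrite (le_trans _ (ler_hnD _ _)) // addrA subrK. Qed.
Lemma hnZ c v : hn (c *: v) = rnorm c * hn v.
Proof. by apply: complexI; rewrite -hnE normrZ rmorphM /= -hnE rnormE. Qed.
Lemma ip_hn v : ip H v v = real_complex R (hn v ^+ 2).
Proof. by rewrite -ip_norm hnE rmorphXn. Qed.
Lemma hn_sqr v : hn v ^+ 2 = complex.Re (ip H v v).
Proof. by rewrite ip_hn. Qed.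

Lemma cauchy_schwarz u v : rnorm (ip H u v) <= hn u * hn v.
Proof.
have CS : `|ip H u v| ^+ 2 <= ip H u u * ip H v v.
  apply: cauchy_schwarz_scalar; rewrite ?ip_ge0 // => l.
  have := ip_ge0 (u + l *: v).
  rewrite ipDl !ipDr !ipZl !ipZr -(ipC v u) mulrA -normCK.
  move=> h; apply: le_trans h _.
  by rewrite le_eqVlt; apply/orP; left; apply/eqP; ring.
rewrite -(ler_pXn2r (n := 2)) ?nnegrE ?mulr_ge0 ?hn_ge0 ?rnorm_ge0 //.
by rewrite -lecR !realcX realcM exprMn -!realcX -!ip_hn realcX -rnormE.
Qed.

Lemma parallelogram u v :
  hn (u + v) ^+ 2 + hn (u - v) ^+ 2 = 2 * (hn u ^+ 2 + hn v ^+ 2).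
Proof.
apply: complexI; rewrite realcM !realcD -!ip_hn.
have -> : real_complex R 1 = 1 by [].
rewrite !(ipBl, ipDl) !(ipBr, ipDr); ring.
Qed.

Definition slim (f : nat -> H) v :=
  forall e : R, 0 < e -> exists N, forall n, (N <= n)%N -> hn (f n - v) < e.

Lemma hilbert_complete (f : nat -> H) :
  (forall e : R, 0 < e ->
     exists N, forall m n, (N <= m)%N -> (N <= n)%N -> hn (f m - f n) < e) ->
  exists v, slim f v.
Proof.
move=> cf.
have : cvg (f @ \oo).
  apply/cauchy_cvgP/cauchy_exP => e e0.
  have er : e = real_complex R (complex.Re e) by rewrite RRe_real ?gtr0_real.
  have re0 : 0 < complex.Re e by rewrite -ltcR -er.
  have [N hN] := cf _ re0.
  exists (f N); exists N => // n /= Nn.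
  by rewrite -ball_normE /ball_ /= hnE er ltcR; apply: hN.
move=> /cvg_ex [l fl]; exists l => e e0.
have e0' : 0 < real_complex R e by rewrite ltcR.
move/cvgrPdist_lt : fl => /(_ _ e0') [N _ hN]; exists N => n Nn.
by have := hN n Nn; rewrite /= hnE ltcR hn_distC.
Qed.

Definition adherent (A : set H) v :=
  forall e : R, 0 < e -> exists2 a, A a & hn (a - v) < e.

Lemma closure_adherentP (A : set H) v : closure A v <-> adherent A v.
Proof.
split=> [cA e e0|aA B].
  have e0' : 0 < real_complex R e by rewrite ltcR.
  have [w [Aw]] := cA _ (nbhsx_ballx v _ e0').
  by rewrite -ball_normE /ball_ /= hnE ltcR hn_distC => h; exists w.
rewrite -nbhs_ballE => -[e /= e0 eB].
have er : e = real_complex R (complex.Re e) by rewrite RRe_real ?gtr0_real.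
have re0 : 0 < complex.Re e by rewrite -ltcR -er.
have [a Aa h] := aA _ re0; exists a; split=> //; apply: eB.
by rewrite -ball_normE /ball_ /= hnE er ltcR hn_distC.
Qed.

Definition hbounded S := exists C : R, forall v, hn (S v) <= C * hn v.

Lemma hboundedW S : hbounded S -> exists2 C : R, 0 < C & forall v, hn (S v) <= C * hn v.
Proof.
move=> [C h]; exists (`|C| + 1); first by rewrite ltr_wpDl.
move=> v; rewrite (le_trans (h v)) // ler_wpM2r ?hn_ge0 //.
by rewrite (le_trans (ler_norm _)) // lerDl.
Qed.

Lemma bounded_opP S : bounded_op S <-> linear S /\ hbounded S.
Proof.
split=> -[lS]; last first.
  move=> /hboundedW [C C0 hC]; split=> // v; apply/cvgrPdist_lt => e e0.
  have er : e = real_complex R (complex.Re e) by rewrite RRe_real ?gtr0_real.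
  have re0 : 0 < complex.Re e by rewrite -ltcR -er.
  have d0 : 0 < real_complex R (complex.Re e / C) by rewrite ltcR divr_gt0.
  apply/nbhs_ballP; exists (real_complex R (complex.Re e / C)) => //= w.
  rewrite -ball_normE /ball_ /= hnE ltcR ltr_pdivlMr // => h.
  have -> : S v - S w = S (v - w) by rewrite addrC -scaleN1r -lS scaleN1r addrC.
  by rewrite hnE er ltcR (le_lt_trans (hC _)) // mulrC.
move=> cS; split=> //.
pose f := GRing.isLinear.Build _ _ _ _ S lS.
pose g : {linear H -> H} := HB.pack S f.
have := (@linear_boundedP _ _ _ g).1.
have cg : {for 0, continuous g} by exact: cS.
move=> /(_ (continuous_linear_bounded 0 cg)) /pinfty_ex_gt0 [M M0 hM].
exists (complex.Re M) => v.
have := hM v; rewrite /= !hnE.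
by rewrite -{1}(RRe_real (gtr0_real M0)) -rmorphM /= lecR.
Qed.
End Hilbert.

(** * Projections onto closed convex sets *)

Section Projection.
Context {R : realType} {H : hilbertSpace R}.
Implicit Types (u v w x : H) (c : R[i]) (S T P : H -> H) (W : set H).

Lemma invS_lt (e : R) : 0 < e -> exists N, forall n, (N <= n)%N -> n.+1%:R^-1 < e.
Proof.
move=> e0; exists (truncn e^-1) => n hn.
by rewrite invf_plt ?posrE // (lt_le_trans (truncnS_gt _)) // ler_nat.
Qed.

(** The parallelogram law makes minimizing sequences Cauchy, and it involves midpoints only, so
    midpoint convexity suffices. *)
Lemma convex_min W w0 :
  W w0 -> (forall u v, W u -> W v -> W ((2^-1 : R[i]) *: (u + v))) ->
  (forall v, adherent W v -> W v) ->
  exists2 v, W v & forall w, W w -> hn v <= hn w.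
Proof.
move=> W0 Wc Wcl.
pose D := inf [set hn w ^+ 2 | w in W].
have hinf : has_inf [set hn w ^+ 2 | w in W].
  split; first by exists (hn w0 ^+ 2), w0.
  by exists 0 => _ [w _ <-]; rewrite sqr_ge0.
have Dle w : W w -> D <= hn w ^+ 2 by move=> Ww; apply: ge_inf; [exact: hinf.2|exists w].
have ex n : exists w, W w /\ hn w ^+ 2 < D + n.+1%:R^-1.
  have e0 : (0 : R) < n.+1%:R^-1 by rewrite invr_gt0.
  by have [_ [w Ww <-] h] := inf_adherent e0 hinf; exists w.
have [f hf] := choice ex.
have key u v : W u -> W v -> hn (u - v) ^+ 2 <= 2 * (hn u ^+ 2 + hn v ^+ 2) - 4 * D.
  move=> Wu Wv; have := Dle _ (Wc _ _ Wu Wv).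
  have -> : hn ((2^-1 : R[i]) *: (u + v)) ^+ 2 = hn (u + v) ^+ 2 / 4.
    by rewrite hnZ rnorm_half; field.
  have := parallelogram u v; nra.
have [v fv] : exists v, slim f v.
  apply: hilbert_complete => e e0.
  have [N hN] : exists N, forall n, (N <= n)%N -> n.+1%:R^-1 < e ^+ 2 / 4.
    by apply: invS_lt; rewrite divr_gt0 // exprn_gt0.
  exists N => m n mN nN.
  rewrite -(ltr_pXn2r (n := 2)) ?nnegrE ?hn_ge0 ?(ltW e0) //.
  apply: le_lt_trans (key _ _ (hf m).1 (hf n).1) _.
  have := (hf m).2; have := (hf n).2; have := hN _ mN; have := hN _ nN.
  move: (n.+1%:R^-1) (m.+1%:R^-1) (hn (f m) ^+ 2) (hn (f n) ^+ 2) (e ^+ 2).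
  by move=> a b x y z; lra.
exists v.
  by apply: Wcl => e /fv [N hN]; exists (f N); [exact: (hf N).1|exact: hN].
move=> w Ww; rewrite leNgt; apply/negP => vw.
(* Within half the gap of [v], the norm of [f n] exceeds [hn w] by more than half the gap; this
   contradicts a squared norm below [hn w ^+ 2] plus a quarter of the squared gap. *)
have [N1 hN1] : exists N, forall n, (N <= n)%N -> n.+1%:R^-1 < (hn v - hn w) ^+ 2 / 4.
  by apply: invS_lt; rewrite divr_gt0 // exprn_gt0 // subr_gt0.
have d0 : 0 < (hn v - hn w) / 2 by rewrite divr_gt0 // subr_gt0.
have [N2 hN2] := fv _ d0; pose n := maxn N1 N2.
have := hN1 n (leq_maxl _ _); have := hN2 n (leq_maxr _ _).
have := (hf n).2; have := Dle _ Ww.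
have := ler_hnD (f n) (v - f n); rewrite addrC subrK hn_distC.
have := hn_ge0 w; have := hn_ge0 (f n); move: (n.+1%:R^-1) => a; nra.
Qed.

Lemma convex_min_uniq W u v :
  (forall u v, W u -> W v -> W ((2^-1 : R[i]) *: (u + v))) ->
  W u -> W v -> (forall w, W w -> hn u <= hn w) -> hn v = hn u -> u = v.
Proof.
move=> Wc Wu Wv hu vu; apply/eqP; rewrite -subr_eq0; apply/eqP/hn_eq0.
have := hu _ (Wc _ _ Wu Wv); rewrite hnZ rnorm_half.
have := parallelogram u v; rewrite vu.
have := hn_ge0 (u - v); have := hn_ge0 (u + v); have := hn_ge0 u.
move=> *; apply/eqP; rewrite -sqrf_eq0 eq_le sqr_ge0 andbT; nra.
Qed.

Definition subspace W := W 0 /\ forall c u v, W u -> W v -> W (c *: u + v).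

Lemma subspaceZ W c u : subspace W -> W u -> W (c *: u).
Proof. by move=> [W0 Wl] Wu; rewrite -[c *: u]addr0; exact: Wl. Qed.
Lemma subspaceD W u v : subspace W -> W u -> W v -> W (u + v).
Proof. by move=> [W0 Wl] Wu Wv; rewrite -[u]scale1r; exact: Wl. Qed.
Lemma subspaceB W u v : subspace W -> W u -> W v -> W (u - v).
Proof. by move=> sW Wu Wv; rewrite addrC -scaleN1r; apply: sW.2. Qed.

Lemma projection_exists W : subspace W -> (forall v, adherent W v -> W v) ->
  exists P : H -> H, orthogonal_projection W P.
Proof.
move=> sW Wcl.
suff ex v : exists p, W p /\ forall w, W w -> ip H (v - p) w = 0.
  by have [P hP] := choice ex; exists P.
(* These are the residuals of [v] modulo [W]; the shortest one is the component orthogonal to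
   [W]. *)
pose A := [set u | W (v - u)].
have [u Au umin] : exists2 u, A u & forall w, A w -> hn u <= hn w.
  apply: (@convex_min A v).
  - by rewrite /A /= subrr; exact: sW.1.
  - move=> a b Aa Ab; rewrite /A /=.
    have -> : v - (2^-1 : R[i]) *: (a + b) = (2^-1 : R[i]) *: ((v - a) + (v - b)).
      have {1}-> : v = (2^-1 : R[i]) *: (v + v).
        by rewrite -(mulr2n v) -(scaler_nat 2 v) scalerA mulVf ?scale1r // pnatr_eq0.
      by rewrite -scalerBr opprD addrACA.
    by apply: subspaceZ => //; apply: subspaceD.
  - move=> a aA; apply: Wcl => e /aA [b Ab h]; exists (v - b) => //.
    have -> : v - b - (v - a) = - (b - a) by rewrite !opprB addrC addrA subrK.
    by rewrite hnN.
exists (v - u); split=> // w Ww; rewrite subKr.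
have [->|w0] := eqVneq w 0; first by rewrite ip0r.
have nw : ip H w w != 0 by apply: contra_neq w0; exact: ip_eq0.
(* Subtracting the component of [u] along [w] would shorten [u] unless the two are orthogonal. *)
pose l := ip H u w / ip H w w.
have Al : A (u - l *: w).
  by rewrite /A /= opprB addrCA; apply: sW.2.
have := umin _ Al; rewrite -(ler_pXn2r (n := 2)) ?nnegrE ?hn_ge0 // -lecR -!ip_hn.
have nwc : (ip H w w)^* = ip H w w by rewrite -ipC.
rewrite ipBl !ipBr !ipZl !ipZr.
have lc : l^* = (ip H u w)^* / ip H w w by rewrite rmorphM fmorphV /= nwc.
rewrite lc /l (ipC w u).
set x := ip H u w.
have -> : ip H u u - x^* / ip H w w * x -
  (x / ip H w w * x^* - x / ip H w w * (x^* / ip H w w * ip H w w))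
  = ip H u u - `|x| ^+ 2 / ip H w w by rewrite normCK; field.
rewrite lerBrDr gerDl => h; apply/eqP; rewrite -normr_eq0 -sqrf_eq0.
have ww0 : 0 < ip H w w by rewrite lt_def nw ip_ge0.
by rewrite eq_le exprn_ge0 // andbT -(pmulr_lle0 _ (_ : 0 < (ip H w w)^-1)) ?invr_gt0.
Qed.
End Projection.

(** * Adjoints and resolvents *)

Section OperatorTheory.
Context {R : realType} {H : hilbertSpace R}.
Implicit Types (u v w x : H) (c : R[i]) (S T P : H -> H) (W : set H).
Implicit Types (M X : set (H -> H)).

Lemma subrACA u v w x : u - v - (w - x) = (u - w) - (v - x).
Proof. by rewrite !opprB ![_ + (x - _)]addrCA addrAC. Qed.

Section LinearFun.
Variable T : H -> H.
Hypothesis lT : linear T.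
Lemma lin0 : T 0 = 0.
Proof.
have := lT (-1) 0 0; rewrite scaler0 addr0 scaleN1r => h.
by rewrite {1}h addNr.
Qed.
Lemma linZ c u : T (c *: u) = c *: T u.
Proof. by rewrite -[c *: u]addr0 lT lin0 addr0. Qed.
Lemma linD u v : T (u + v) = T u + T v.
Proof. by rewrite -[u]scale1r lT !scale1r. Qed.
Lemma linB u v : T (u - v) = T u - T v.
Proof. by rewrite linD -scaleN1r linZ scaleN1r. Qed.
End LinearFun.

Lemma adherent_closed (W : set H) : forall v, adherent (adherent W) v -> adherent W v.
Proof.
move=> v aW e e0; have e2 : 0 < e / 2 by rewrite divr_gt0.
have [a aa h1] := aW _ e2; have [b Wb h2] := aa _ e2; exists b => //.
by have := ler_hn_dist a b v; lra.
Qed.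

Lemma adherent_subspace W : subspace W -> subspace (adherent W).
Proof.
move=> sW; split=> [e e0|c u v au av e e0].
  by exists 0; rewrite ?subrr ?hn0 //; exact: sW.1.
have e2 : 0 < e / 2 by rewrite divr_gt0.
have d0 : 0 < rnorm c + 1 by rewrite ltr_wpDl ?rnorm_ge0.
have [a Wa ha] := au _ (divr_gt0 e2 d0); have [b Wb hb] := av _ e2.
exists (c *: a + b); first exact: sW.2.
have -> : c *: a + b - (c *: u + v) = c *: (a - u) + (b - v).
  by rewrite opprD addrACA scalerBr.
have := ler_hnD (c *: (a - u)) (b - v); rewrite hnZ.
have : rnorm c * hn (a - u) <= e / 2.
  move: ha; rewrite ltr_pdivlMr // => ha.
  by have := hn_ge0 (a - u); have := rnorm_ge0 c; nra.
lra.
Qed.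

Lemma closureE W : closure W = adherent W.
Proof. by apply/seteqP; split=> v /closure_adherentP. Qed.

Section OrthogonalProjection.
Variables (W : set H) (P : H -> H).
Hypotheses (sW : subspace W) (pP : orthogonal_projection W P).

Lemma proj_uniq v p : W p -> (forall w, W w -> ip H (v - p) w = 0) -> P v = p.
Proof.
move=> Wp h; have [Wv hv] := pP v.
apply/eqP; rewrite -subr_eq0; apply/eqP/ip_eq0.
have Wd : W (P v - p) by exact: subspaceB.
have e : P v - p = (v - p) - (v - P v) by rewrite opprB [RHS]addrC addrA subrK.
by rewrite {1}e ipBl h // hv // subrr.
Qed.
Lemma proj_in v : W (P v).
Proof. exact: (pP v).1. Qed.
Lemma proj_fix v : W v -> P v = v.
Proof. by move=> Wv; apply: proj_uniq => // w _; rewrite subrr ip0l. Qed.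
Lemma proj_ip v w : W w -> ip H (P v) w = ip H v w.
Proof. by move=> /(pP v).2; rewrite ipBl => /eqP; rewrite subr_eq0 => /eqP. Qed.
Lemma proj_adj : adjoint P P.
Proof.
move=> u v; rewrite -(proj_ip u (proj_in v)) ipC [RHS]ipC.
by rewrite (proj_ip v (proj_in u)).
Qed.
Lemma proj_linear : linear P.
Proof.
move=> c u v; apply: proj_uniq.
  by apply: sW.2; exact: proj_in.
move=> w Ww; have -> : c *: u + v - (c *: P u + P v) = c *: (u - P u) + (v - P v).
  by rewrite opprD addrACA scalerBr.
by rewrite ipDl ipZl !(pP _).2 // mulr0 addr0.
Qed.
Lemma proj_bound v : hn (P v) <= hn v.
Proof.
have h : ip H (P v) (P v) = ip H v (P v) by rewrite proj_ip //; exact: proj_in.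
have := cauchy_schwarz v (P v).
have -> : rnorm (ip H v (P v)) = hn (P v) ^+ 2.
  by apply: complexI; rewrite -rnormE -h ip_hn ger0_norm // ler0c sqr_ge0.
have := hn_ge0 (P v); rewrite le0r => /orP[/eqP->|p0]; first by rewrite hn_ge0.
by rewrite expr2 ler_pM2r.
Qed.
Lemma proj_bounded : bounded_op P.
Proof.
apply/bounded_opP; split; first exact: proj_linear.
by exists 1 => v; rewrite mul1r proj_bound.
Qed.
End OrthogonalProjection.

Lemma bounded_lin T : bounded_op T -> linear T.
Proof. by case. Qed.

Lemma bounded_opC T : bounded_op T -> exists2 C : R, 0 < C & forall v, hn (T v) <= C * hn v.
Proof. by move=> /bounded_opP[_ /hboundedW]. Qed.

Lemma adherent_map (W W' : set H) T : bounded_op T ->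
  (forall v, W v -> adherent W' (T v)) -> forall v, adherent W v -> adherent W' (T v).
Proof.
move=> bT TW v av; apply: adherent_closed => e e0.
have [C C0 hC] := bounded_opC bT.
have [a Wa ha] := av _ (divr_gt0 e0 C0); exists (T a); first exact: TW.
rewrite -(linB (bounded_lin bT)) (le_lt_trans (hC _)) //.
by move: ha; rewrite ltr_pdivlMr // mulrC.
Qed.


Lemma riesz (f : H -> R[i]) (C : R) :
  (forall c u v, f (c *: u + v) = c * f u + f v) ->
  (forall v, rnorm (f v) <= C * hn v) -> exists y, forall v, f v = ip H v y.
Proof.
move=> lf bf.
have f0 : f 0 = 0.
  have := lf (-1) 0 0; rewrite scaler0 addr0 mulN1r addNr => h; exact: h.
have fB u v : f (u - v) = f u - f v by rewrite addrC -scaleN1r lf mulN1r addrC.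
have fZ c u : f (c *: u) = c * f u by rewrite -[c *: u]addr0 lf f0 addr0.
have [[v0 fv0]|nf] := pselect (exists v, f v != 0); last first.
  exists 0 => v; rewrite ip0r; apply/eqP; apply: contrapT => /negP h.
  by apply: nf; exists v.
have sk : subspace [set v | f v = 0].
  by split=> //= c u v /= hu hv; rewrite lf hu hv mulr0 addr0.
have kc v : adherent [set v | f v = 0] v -> f v = 0.
  move=> av; apply: rnorm_eq0; apply/eqP; rewrite eq_le rnorm_ge0 andbT.
  apply/ler_addgt0Pr => e e0; rewrite add0r.
  have d0 : 0 < `|C| + 1 by rewrite ltr_wpDl.
  have [a /= fa ha] := av _ (divr_gt0 e0 d0).
  have -> : f v = f (v - a) by rewrite fB fa subr0.
  rewrite (le_trans (bf _)) // hn_distC.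
  move: ha; rewrite ltr_pdivlMr //.
  by have := ler_norm C; have := hn_ge0 (a - v); nra.
have [P hP] := projection_exists sk kc.
pose z := v0 - P v0.
have fz : f z = f v0 by rewrite fB (hP v0).1 subr0.
have fz0 : f z != 0 by rewrite fz.
have z0 : ip H z z != 0.
  by apply: contra_neq fz0 => /ip_eq0 ->.
exists ((f z)^* / ip H z z *: z) => v.
have k : f (v - (f v / f z) *: z) = 0 by rewrite fB fZ divfK // subrr.
have := (hP v0).2 _ k; rewrite -/z ipC ipBl ipZl => /eqP.
rewrite conjC_eq0 subr_eq0 => /eqP h.
rewrite ipZr h rmorphM /= fmorphV /= conjCK.
have -> : (ip H z z)^* = ip H z z by rewrite -ipC.
by field; rewrite fz0.
Qed.

Lemma adjoint_sym S T : adjoint S T -> adjoint T S.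
Proof. by move=> h u v; rewrite ipC -h -ipC. Qed.
Lemma adjoint_uniq S T T' : adjoint S T -> adjoint S T' -> T = T'.
Proof.
move=> h h'; apply/funext => v; apply: ip_ext => w.
by rewrite ipC [RHS]ipC -h -h'.
Qed.
Lemma adjoint_linear S T : adjoint S T -> linear T.
Proof.
move=> h c u v; apply: ip_ext => w.
by rewrite ipC -h ipDr ipZr !h ipDl ipZl rmorphD rmorphM /= conjCK -!ipC.
Qed.
Lemma adjoint_bounded S T : bounded_op S -> adjoint S T -> bounded_op T.
Proof.
move=> bS h; apply/bounded_opP; split; first exact: adjoint_linear h.
have [C C0 hC] := bounded_opC bS; exists C => v.
have := hn_ge0 (T v); rewrite le0r => /orP[/eqP->|p0].
  by rewrite mulr_ge0 ?hn_ge0 // ltW.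
rewrite -(ler_pM2l p0) -expr2.
have -> : hn (T v) ^+ 2 = rnorm (ip H (S (T v)) v).
  by apply: complexI; rewrite -rnormE h ip_hn ger0_norm // ler0c sqr_ge0.
rewrite (le_trans (cauchy_schwarz _ _)) // mulrA ler_wpM2r ?hn_ge0 //.
by rewrite mulrC hC.
Qed.
Lemma adjoint_exists S : bounded_op S -> exists2 T, adjoint S T & bounded_op T.
Proof.
move=> bS; suff [T hT] : exists T, adjoint S T.
  by exists T => //; exact: adjoint_bounded hT.
have [C C0 hC] := bounded_opC bS.
suff /choice[T hT] : forall v, exists y, forall u, ip H (S u) v = ip H u y.
  by exists T => u v.
move=> v; apply: (@riesz (fun u => ip H (S u) v) (C * hn v)).
  by move=> c u w; rewrite (bounded_lin bS) ipDl ipZl.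
move=> u; rewrite (le_trans (cauchy_schwarz _ _)) // mulrAC ler_wpM2r ?hn_ge0 //.
Qed.

Lemma adjoint_comp S S' T T' :
  adjoint S S' -> adjoint T T' -> adjoint (S \o T) (T' \o S').
Proof. by move=> h h' u v /=; rewrite h h'. Qed.
Lemma adjoint_id : adjoint (@id H) id.
Proof. by []. Qed.
Lemma adjoint_lin c S S' T T' : adjoint S S' -> adjoint T T' ->
  adjoint (fun v => c *: S v + T v) (fun v => c^* *: S' v + T' v).
Proof. by move=> h h' u v /=; rewrite ipDl ipDr ipZl ipZr conjCK h h'. Qed.

(** Skew-adjointness gives [|v - T v|^2 = |v|^2 + |T v|^2], so [1 - T] is bounded below and has
    closed range. The resolvents obtained here are the source of unitaries for the averaging. *)
Lemma skew_resolvent T : bounded_op T -> (forall u v, ip H (T u) v = - ip H u (T v)) ->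
  exists b, [/\ bounded_op b, forall w, b w - T (b w) = w & forall w, b (w - T w) = w].
Proof.
move=> bT sT; have lT := bounded_lin bT.
have re v : complex.Re (ip H (T v) v) = 0.
  have /(congr1 (@complex.Re R)) : ip H (T v) v = - (ip H (T v) v)^* by rewrite -ipC sT.
  case: (ip H (T v) v) => x y /=; lra.
have lb v : hn v <= hn (v - T v).
  rewrite -(ler_pXn2r (n := 2)) ?nnegrE ?hn_ge0 //.
  have -> : hn (v - T v) ^+ 2 = hn v ^+ 2 + hn (T v) ^+ 2.
    rewrite !hn_sqr ipBl !ipBr (ipC v (T v)).
    have := re v; case: (ip H (T v) v) => x y /= ->.
    by case: (ip H v v) => ? ?; case: (ip H (T v) (T v)) => ? ? /=; ring.
  by rewrite lerDl sqr_ge0.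
pose W := [set w | exists v, v - T v = w].
have sub : forall c u v, (c *: u + v) - T (c *: u + v) = c *: (u - T u) + (v - T v).
  by move=> c u v; rewrite lT opprD addrACA scalerBr.
have sW : subspace W.
  split; first by exists 0; rewrite (lin0 lT) subr0.
  by move=> c _ _ [u <-] [v <-]; exists (c *: u + v).
have Wc v : adherent W v -> W v.
  move=> av.
  have ex n : exists a, hn (a - T a - v) < n.+1%:R^-1.
    have n0 : (0 : R) < n.+1%:R^-1 by rewrite invr_gt0.
    by have [_ [a <-] h] := av _ n0; exists a.
  have [f hf] := choice ex.
  have [l fl] : exists l, slim f l.
    apply: hilbert_complete => e e0.
    have [N hN] : exists k, forall n, (k <= n)%N -> n.+1%:R^-1 < e / 2.
      by apply: invS_lt; rewrite divr_gt0.
    exists N => m n mN nN; apply: le_lt_trans (lb _) _.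
    have -> : f m - f n - T (f m - f n) = (f m - T (f m)) - (f n - T (f n)).
      by rewrite (linB lT) subrACA.
    have := ler_hn_dist v (f m - T (f m)) (f n - T (f n)).
    rewrite (hn_distC v).
    have := hf m; have := hf n; have := hN _ mN; have := hN _ nN.
    by move: (n.+1%:R^-1) (m.+1%:R^-1) => a b; lra.
  exists l; apply/eqP; rewrite -subr_eq0; apply/eqP/hn_eq0/eqP.
  rewrite eq_le hn_ge0 andbT; apply/ler_addgt0Pr => e e0; rewrite add0r.
  have [C C0 hC] := bounded_opC bT.
  have [N1 hN1] : exists k, forall n, (k <= n)%N -> n.+1%:R^-1 < e / 2.
    by apply: invS_lt; rewrite divr_gt0.
  have d0 : 0 < e / 2 / (1 + C) by rewrite !divr_gt0 // addr_gt0.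
  have [N2 hN2] := fl _ d0; pose n := maxn N1 N2.
  have h1 := hN1 n (leq_maxl _ _); have h2 := hN2 n (leq_maxr _ _).
  have := ler_hn_dist (f n - T (f n)) (l - T l) v.
  have -> : l - T l - (f n - T (f n)) = (l - f n) - T (l - f n).
    by rewrite (linB lT) subrACA.
  have := ler_hnD (l - f n) (- T (l - f n)); rewrite hnN.
  have := hC (l - f n); rewrite (hn_distC l).
  move: h2; rewrite ltr_pdivlMr ?addr_gt0 // mulrDr mulr1 [hn _ * C]mulrC.
  have := hf n; move: h1; move: (n.+1%:R^-1) => a; lra.
have [P hP] := projection_exists sW Wc.
have onto w : W w.
  suff -> : w = P w by exact: proj_in hP _.
  (* The residual [y] is orthogonal to the range, in particular to [y - T y]; the real part of that
     relation is [|y|^2 = 0]. *)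
  apply/eqP; rewrite -subr_eq0; apply/eqP; set y := w - P w.
  have : ip H y (y - T y) = 0 by apply: (hP w).2; exists y.
  rewrite ipBr => /(congr1 (@complex.Re R)).
  rewrite (ipC y (T y)); have := re y; case: (ip H (T y) y) => a b /= ->.
  rewrite -/y; have := hn_sqr y; case: (ip H y y) => a' b' /= <-; rewrite subr0.
  by move=> /eqP; rewrite sqrf_eq0 => /eqP /hn_eq0.
have [b hb] := choice onto.
have inj u v : u - T u = v - T v -> u = v.
  move=> h; apply/eqP; rewrite -subr_eq0; apply/eqP/hn_eq0/eqP.
  rewrite eq_le hn_ge0 andbT (le_trans (lb _)) //.
  by rewrite (linB lT) subrACA h subrr hn0.
exists b; split=> //; last by move=> w; apply: inj; rewrite hb.
apply/bounded_opP; split.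
  by move=> c u v; apply: inj; rewrite hb sub !hb.
by exists 1 => w; rewrite mul1r -{2}(hb w) lb.
Qed.
End OperatorTheory.

(** * Operator algebras, traces and GNS representations *)

Section OperatorAlgebras.
Context {R : realType} {H : hilbertSpace R}.
Implicit Types (u v w x : H) (c : R[i]) (S T P : H -> H).
Implicit Types (M X : set (H -> H)) (t : (H -> H) -> R[i]).

(** These closure properties pass to relative commutants without any bicommutant argument. *)
Record opalg M : Prop := {
  oa_bounded : forall T, M T -> bounded_op T;
  oa_id : M id;
  oa_comp : forall S T, M S -> M T -> M (S \o T);
  oa_lin : forall c S T, M S -> M T -> M (fun v => c *: S v + T v);
  oa_adj : forall S, M S -> exists2 T, M T & adjoint S T }.

Lemma bounded_id : bounded_op (@id H).
Proof. by apply/bounded_opP; split=> //; exists 1 => v; rewrite mul1r. Qed.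
Lemma bounded_comp S T : bounded_op S -> bounded_op T -> bounded_op (S \o T).
Proof.
move=> bS bT; apply/bounded_opP; split.
  by move=> c u v /=; rewrite (bounded_lin bT) (bounded_lin bS).
have [C C0 hC] := bounded_opC bS; have [C' C0' hC'] := bounded_opC bT.
exists (C * C') => v /=; rewrite (le_trans (hC _)) // -mulrA.
by rewrite ler_wpM2l // ltW.
Qed.
Lemma bounded_comb c S T : bounded_op S -> bounded_op T ->
  bounded_op (fun v => c *: S v + T v).
Proof.
move=> bS bT; apply/bounded_opP; split.
  move=> d u v; rewrite (bounded_lin bT) (bounded_lin bS) !scalerDr !scalerA.
  by rewrite addrACA [c * d]mulrC.
have [C C0 hC] := bounded_opC bS; have [C' C0' hC'] := bounded_opC bT.
exists (rnorm c * C + C') => v.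
rewrite (le_trans (ler_hnD _ _)) // hnZ mulrDl lerD // -mulrA.
by rewrite ler_wpM2l ?rnorm_ge0.
Qed.

Lemma commutant_id X : commutant X id.
Proof. by split=> //; exact: bounded_id. Qed.
Lemma commutant_comp X S T : commutant X S -> commutant X T -> commutant X (S \o T).
Proof.
move=> [bS cS] [bT cT]; split=> [|U XU]; first exact: bounded_comp.
by rewrite -compA cT // compA cS.
Qed.
Lemma commutant_lin X c S T : (forall U, X U -> linear U) ->
  commutant X S -> commutant X T -> commutant X (fun v => c *: S v + T v).
Proof.
move=> lX [bS cS] [bT cT]; split=> [|U XU]; first exact: bounded_comb.
apply/funext => v /=; rewrite lX //; congr (_ *: _ + _).
  exact: (congr1 (@^~ v) (cS U XU)).
exact: (congr1 (@^~ v) (cT U XU)).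
Qed.
Lemma commutant_adj X S T : (forall U, X U -> exists2 V, X V & adjoint U V) ->
  commutant X S -> adjoint S T -> commutant X T.
Proof.
move=> aX [bS cS] aST; split=> [|U XU]; first exact: adjoint_bounded aST.
have [V XV aUV] := aX U XU.
apply: adjoint_uniq (adjoint_comp (adjoint_sym aUV) aST) _.
by rewrite -cS //; apply: adjoint_comp => //; exact: adjoint_sym.
Qed.

Lemma commutantP X T U v : commutant X T -> X U -> T (U v) = U (T v).
Proof. by move=> [_ h] XU; exact: (congr1 (@^~ v) (h U XU)). Qed.
Lemma commutant_mem M S : (forall T, M T -> bounded_op T) -> M S ->
  commutant (commutant M) S.
Proof. by move=> bM MS; split=> [|T [_ cT]]; [exact: bM|rewrite cT]. Qed.

Lemma von_neumann_opalg M : von_neumann M -> opalg M.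
Proof.
move=> [aM cM]; split=> //.
- by move=> T; rewrite -cM => -[].
- by rewrite -cM; exact: commutant_id.
- by rewrite -cM; exact: commutant_comp.
- by rewrite -cM => c S T; apply: commutant_lin => U [/bounded_lin].
Qed.

Lemma relcomm_opalg N M : opalg N -> opalg M -> opalg (relcomm N M).
Proof.
move=> aN aM; split.
- by move=> T [_ /(oa_bounded aM)].
- by split; [exact: commutant_id|exact: oa_id].
- by move=> S T [? ?] [? ?]; split; [exact: commutant_comp|exact: oa_comp].
- move=> c S T [? ?] [? ?]; split; last exact: oa_lin.
  by apply: commutant_lin => // U /(oa_bounded aN)/bounded_lin.
- move=> S [cS MS]; have [T MT aT] := oa_adj aM MS; exists T => //; split=> //.
  by apply: commutant_adj aT => // U; exact: oa_adj.
Qed.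

Section OpalgTheory.
Variable M : set (H -> H).
Hypothesis aM : opalg M.
Lemma oa_linear T : M T -> linear T.
Proof. by move/(oa_bounded aM)/bounded_lin. Qed.
Lemma oa_zero : M (fun=> 0).
Proof.
have := oa_lin aM (-1) (oa_id aM) (oa_id aM); congr (M _); apply/funext => v.
by rewrite scaleN1r addNr.
Qed.
Lemma oa_scale c T : M T -> M (fun v => c *: T v).
Proof.
move=> MT; have := oa_lin aM c MT oa_zero; congr (M _); apply/funext => v.
by rewrite addr0.
Qed.
Lemma oa_sub S T : M S -> M T -> M (fun v => S v - T v).
Proof.
move=> MS MT; have := oa_lin aM (-1) MT MS; congr (M _); apply/funext => v.
by rewrite scaleN1r addrC.
Qed.
Lemma oa_mem_adj S T : M S -> adjoint S T -> M T.
Proof.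
by move=> MS aST; have [T' MT' aST'] := oa_adj aM MS; rewrite (adjoint_uniq aST aST').
Qed.
End OpalgTheory.

Lemma adjoint_sub c S S' T T' : adjoint S S' -> adjoint T T' ->
  adjoint (fun v => S v - c *: T v) (fun v => S' v - c^* *: T' v).
Proof. by move=> h h' u v /=; rewrite ipBl ipBr ipZl ipZr conjCK h h'. Qed.

(** * Trace norm and Cauchy-Schwarz for a faithful trace *)

Section Trace.
Variables (M : set (H -> H)) (t : (H -> H) -> R[i]).
Hypotheses (aM : opalg M) (tM : normalized_trace M t).

Lemma tr0 : t (fun=> 0) = 0.
Proof.
have z := oa_zero aM; have := ntr_linear tM (-1) z z.
rewrite mulN1r addNr => <-; congr t; apply/funext => v; by rewrite scaler0 addr0.
Qed.
Lemma trZ c T : M T -> t (fun v => c *: T v) = c * t T.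
Proof.
move=> MT; rewrite -[RHS]addr0 -tr0 -(ntr_linear tM) //; last exact: oa_zero.
by congr t; apply/funext => v; rewrite addr0.
Qed.
Lemma trB S T : M S -> M T -> t (fun v => S v - T v) = t S - t T.
Proof.
move=> MS MT; rewrite addrC -mulN1r -(ntr_linear tM) //.
by congr t; apply/funext => v; rewrite scaleN1r addrC.
Qed.

(** This is the expanded squared trace norm of [S - c T]. Its sign yields inequalities between
    traces, and its vanishing turns a numerical identity into an identity of operators. *)
Lemma tr_dist c S S' T T' : M S -> M T -> adjoint S S' -> adjoint T T' ->
  0 <= t (S' \o S) - c * t (S' \o T) - c^* * t (T' \o S) + c * c^* * t (T' \o T) /\
  (t (S' \o S) - c * t (S' \o T) - c^* * t (T' \o S) + c * c^* * t (T' \o T) = 0 ->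
   S = (fun v => c *: T v)).
Proof.
move=> MS MT aS aT.
have MS' := oa_mem_adj aM MS aS; have MT' := oa_mem_adj aM MT aT.
have MD := oa_sub aM MS (oa_scale aM c MT).
have MD' := oa_sub aM MS' (oa_scale aM c^* MT').
have aD := adjoint_sub c aS aT.
have e : t ((fun v => S' v - c^* *: T' v) \o (fun v => S v - c *: T v)) =
  t (S' \o S) - c * t (S' \o T) - c^* * t (T' \o S) + c * c^* * t (T' \o T).
  transitivity (t (fun v => ((S' \o S) v - c *: (S' \o T) v) -
                            (c^* *: ((T' \o S) v - c *: (T' \o T) v)))).
    congr t; apply/funext => v /=.
    have lS' := oa_linear aM MS'; have lT' := oa_linear aM MT'.
    by rewrite (linB lS') (linB lT') (linZ lS') (linZ lT').
  have [m1 m2 m3 m4] : [/\ M (S' \o S), M (S' \o T), M (T' \o S) & M (T' \o T)].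
    by split; exact: oa_comp.
  have n2 := oa_scale aM c m2; have n4 := oa_scale aM c m4.
  have n3 := oa_sub aM m3 n4.
  rewrite (trB (oa_sub aM m1 n2) (oa_scale aM c^* n3)) (trZ _ n3).
  rewrite (trB m1 n2) (trB m3 n4) (trZ _ m2) (trZ _ m4).
  by ring.
rewrite -e; split; first exact: (ntr_pos tM MD MD' aD).
move=> /(ntr_faithful tM MD MD' aD) /(congr1 (fun f v => f v)) h.
by apply/funext => v; apply/eqP; rewrite -subr_eq0 (congr1 (@^~ v) h).
Qed.

(** Hermitian symmetry is extracted from positivity: the squared trace norm of [T - c] is real, and
    the cases [c = 1] and [c = 'i] determine the real and imaginary parts. *)
Lemma tr_star T T' : M T -> adjoint T T' -> t T' = (t T)^*.
Proof.
move=> MT aT; have MT' := oa_mem_adj aM MT aT.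
have r c : - c * t T' - c^* * t T \is Num.real.
  have [h _] := tr_dist c MT (oa_id aM) aT (@adjoint_id _ _).
  have h1 := ger0_real h.
  have r1 : t (T' \o T) \is Num.real by apply: ger0_real; exact: (ntr_pos tM MT MT' aT).
  have r2 : c * c^* * t (id \o id) \is Num.real.
    by rewrite -normCK (ntr_id tM) mulr1 rpredX // normr_real.
  suff -> : - c * t T' - c^* * t T = (t (T' \o T) - c * t T' - c^* * t T +
      c * c^* * t (id \o id)) - t (T' \o T) - c * c^* * t (id \o id).
    exact: (rpredB (rpredB h1 r1) r2).
  by ring.
have h1 : (t T' + t T)^* = t T' + t T.
  by apply/CrealP; have := r 1; rewrite rmorph1 mulN1r mul1r -opprD rpredN.
have h2 : ('i * (t T - t T'))^* = 'i * (t T - t T').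
  apply/CrealP; have := r 'i; rewrite conjCi.
  by have -> : - 'i * t T' - - 'i * t T = 'i * (t T - t T') by ring.
move: h1 h2; rewrite rmorphD rmorphM rmorphB /= conjCi mulNr -mulrN => h1.
move=> /(mulfI (neq0Ci _)) h2.
have : 2 * t T' = 2 * (t T)^*.
  have -> : 2 * t T' = (t T' + t T) - (t T - t T') by ring.
  by rewrite -h1 -h2; ring.
by apply: mulfI; rewrite pnatr_eq0.
Qed.

Lemma tr_cauchy_schwarz S S' T T' : M S -> M T -> adjoint S S' -> adjoint T T' ->
  `|t (S' \o T)| ^+ 2 <= t (S' \o S) * t (T' \o T).
Proof.
move=> MS MT aS aT.
have MS' := oa_mem_adj aM MS aS; have MT' := oa_mem_adj aM MT aT.
have e : t (T' \o S) = (t (S' \o T))^*.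
  apply: tr_star; first exact: oa_comp.
  by apply: adjoint_comp => //; exact: adjoint_sym.
apply: cauchy_schwarz_scalar; [exact: (ntr_pos tM MS MS' aS)|exact: (ntr_pos tM MT MT' aT)|].
move=> l; have [h _] := tr_dist (- l^*) MS MT aS aT; apply: le_trans h _.
rewrite le_eqVlt; apply/orP; left; apply/eqP.
rewrite rmorphN /= conjCK normCK e; ring.
Qed.
End Trace.
End OperatorAlgebras.

(** * GNS representations *)

Section GNS.
Context {R : realType} {H K : hilbertSpace R}.
Variables (M : set (H -> H)) (t : (H -> H) -> R[i]).
Variables (rho : (H -> H) -> (K -> K)) (Om : K).
Hypotheses (aM : opalg M) (iM : vn_isomorphism M rho).

Lemma vni_opalg : opalg (rho @` M).
Proof. exact: von_neumann_opalg (vni_range iM). Qed.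
Lemma rho_bounded T : M T -> bounded_op (rho T).
Proof. by move=> MT; apply: (oa_bounded vni_opalg); exists T. Qed.
Lemma rho_linear T : M T -> linear (rho T).
Proof. by move=> MT; exact: bounded_lin (rho_bounded MT). Qed.
Lemma rho_comp S T k : M S -> M T -> rho (S \o T) k = rho S (rho T k).
Proof. by move=> MS MT; rewrite (vni_mul iM). Qed.
Lemma rho_zero : rho (fun=> 0) = (fun=> 0).
Proof.
have z := oa_zero aM; have := vni_linear iM (-1) z z.
have -> : (fun v : H => -1 *: (0 : H) + 0) = (fun=> 0).
  by apply/funext => v; rewrite scaler0 addr0.
by move=> ->; apply/funext => v; rewrite scaleN1r addNr.
Qed.
Lemma rho_scale c T : M T -> rho (fun v => c *: T v) = (fun k => c *: rho T k).
Proof.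
move=> MT; have := vni_linear iM c MT (oa_zero aM); rewrite rho_zero.
have -> : (fun v : H => c *: T v + 0) = (fun v => c *: T v).
  by apply/funext => v; rewrite addr0.
by move=> ->; apply/funext => k; rewrite addr0.
Qed.
Lemma rho_sub S T : M S -> M T ->
  rho (fun v => S v - T v) = (fun k => rho S k - rho T k).
Proof.
move=> MS MT; have := vni_linear iM (-1) MT MS.
have -> : (fun v : H => -1 *: T v + S v) = (fun v => S v - T v).
  by apply/funext => v; rewrite scaleN1r addrC.
by move=> ->; apply/funext => k; rewrite scaleN1r addrC.
Qed.

Hypothesis gM : gns M t rho Om.

Lemma gns_ip S T T' : M S -> M T -> adjoint T T' ->
  ip K (rho S Om) (rho T Om) = t (T' \o S).
Proof.
move=> MS MT aT; have MT' := oa_mem_adj aM MT aT.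
rewrite -(gns_state gM); last exact: oa_comp.
by rewrite rho_comp // (vni_star iM MT' MT (adjoint_sym aT)).
Qed.
Lemma gns_dense k : adherent [set rho T Om | T in M] k.
Proof.
apply/closure_adherentP.
have : [set: K] k by []; rewrite -(gns_cyclic gM) /cyclic_subspace.
by congr (closure _ _); apply/seteqP; split=> [_ [_ [T MT <-] <-]|_ [T MT <-]];
  [exists T|exists (rho T) => //; exists T].
Qed.
Lemma cyclicE (N : set (H -> H)) :
  cyclic_subspace (rho @` N) Om = adherent [set rho T Om | T in N].
Proof.
rewrite /cyclic_subspace closureE; congr adherent.
by apply/seteqP; split=> [_ [_ [T MT <-] <-]|_ [T MT <-]];
  [exists T|exists (rho T) => //; exists T].
Qed.
End GNS.

(** * Averaging over the unitary group *)

Lemma le_eps0 (R : realType) (a : R) : (forall e, 0 < e -> a <= e) -> a <= 0.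
Proof. by move=> h; apply/ler_addgt0Pr => e e0; rewrite add0r h. Qed.

Section Averaging.
Context {R : realType} {H K : hilbertSpace R}.
Variables (M M2 N : set (H -> H)) (t : (H -> H) -> R[i]).
Variables (rho : (H -> H) -> (K -> K)) (Om : K) (D : set (K -> K)) (x : H -> H).
Hypotheses (aM : opalg M) (aM2 : opalg M2) (tM2 : normalized_trace M2 t).
Hypotheses (sM : M `<=` M2) (gM : gns M t rho Om).
Let iM : vn_isomorphism M rho := gns_iso gM.

Lemma gns_star T T' : M T -> adjoint T T' -> hn (rho T Om) = hn (rho T' Om).
Proof.
move=> MT aT; have MT' := oa_mem_adj aM MT aT.
have : hn (rho T Om) ^+ 2 = hn (rho T' Om) ^+ 2.
  rewrite !hn_sqr (gns_ip aM iM gM MT MT aT).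
  rewrite (gns_ip aM iM gM MT' MT' (adjoint_sym aT)).
  by rewrite (ntr_comm tM2) //; exact: sM.
by move=> /eqP; rewrite eqrXn2 ?hn_ge0 // => /eqP.
Qed.

(** The involution is isometric on [M Om] by traciality, so right multiplication is estimated
    through left multiplication: [|y a Om| = |a' y' Om| <= C |y' Om| = C |y Om|]. *)
Lemma gns_right_bound a : M a -> exists2 C : R, 0 < C &
  forall y, M y -> hn (rho y (rho a Om)) <= C * hn (rho y Om).
Proof.
move=> Ma; have [a' Ma' aa] := oa_adj aM Ma.
have [C C0 hC] := bounded_opC (rho_bounded iM Ma'); exists C => // y My.
have [y' My' ay] := oa_adj aM My.
rewrite -(rho_comp iM) // (gns_star (oa_comp aM My Ma) (adjoint_comp ay aa)).
by rewrite (rho_comp iM) // (gns_star My ay).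
Qed.

Lemma gns_tr_bound z : M z -> rnorm (t z) <= hn Om * hn (rho z Om).
Proof. by move=> Mz; rewrite -(gns_state gM) // mulrC cauchy_schwarz. Qed.

Lemma gns_inj S T : M S -> M T -> rho S Om = rho T Om -> S = T.
Proof.
move=> MS MT h; have Md := oa_sub aM MS MT; have [d' Md' ad] := oa_adj aM Md.
have : t (d' \o (fun v => S v - T v)) = 0.
  by rewrite -(gns_ip aM iM gM Md Md ad) (rho_sub iM MS MT) h subrr ip0l.
move=> /(ntr_faithful tM2 (sM Md) (sM Md') ad) e; apply/funext => v.
by apply/eqP; rewrite -subr_eq0 (congr1 (@^~ v) e).
Qed.

Hypothesis Mx : M2 x.

Lemma gns_tr_comp_bound : exists2 C : R, 0 < C &
  forall z, M z -> rnorm (t (z \o x)) <= C * hn (rho z Om).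
Proof.
have [x' Mx' ax] := oa_adj aM2 Mx.
(* Cauchy-Schwarz offers the square root of [t (x' \o x)]; one plus the value itself dominates that
   root. *)
exists (1 + rnorm (t (x' \o x))) => [|z Mz].
  by rewrite ltr_wpDr ?rnorm_ge0.
have [z' Mz' az] := oa_adj aM Mz.
have := tr_cauchy_schwarz aM2 tM2 (sM Mz') Mx (adjoint_sym az) ax.
have p : 0 <= t (x' \o x) by exact: (ntr_pos tM2 Mx Mx' ax).
rewrite -(gns_ip aM iM gM Mz' Mz' (adjoint_sym az)) -[X in _ * X](ger0_norm p).
rewrite ip_hn !rnormE -realcX -realcM lecR -(gns_star Mz az).
have := rnorm_ge0 (t (x' \o x)); have := rnorm_ge0 (t (z \o x)).
have := hn_ge0 (rho z Om).
move: (rnorm _) (rnorm _) (hn _) => a b h h0 a0 b0 le.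
rewrite -(ler_pXn2r (n := 2)) ?nnegrE ?mulr_ge0 ?addr_ge0 //.
by rewrite (le_trans le) // exprMn mulrC ler_wpM2r ?sqr_ge0 //; nra.
Qed.

Hypotheses (bD : forall S, D S -> bounded_op S).
(** [D] cuts a subalgebra out of [M], so elements of a smaller algebra can be averaged while working
    on the GNS space of [M]. *)
Let Q y := M y /\ commutant D (rho y).

Let Q_lin c y z : Q y -> Q z -> Q (fun v => c *: y v + z v).
Proof.
move=> [My Dy] [Mz Dz]; split; first exact: oa_lin.
by rewrite (vni_linear iM) //; apply: commutant_lin => // U /bD/bounded_lin.
Qed.

Variable y0 : H -> H.
Variable C : R.
(** The bound [C] lets limits of the vectors [y Om] come from operators; the two trace constraints
    are what will be read off at the averaged element. *)
Let W (k : K) := exists y, [/\ Q y, forall k, hn (rho y k) <= C * hn k,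
  t y = t y0, t (y \o x) = t (y0 \o x) & k = rho y Om].

Let W_closed k : adherent W k -> W k.
Proof.
move=> aW.
have ex n : exists y, [/\ Q y, forall k, hn (rho y k) <= C * hn k,
    t y = t y0, t (y \o x) = t (y0 \o x) & hn (rho y Om - k) < n.+1%:R^-1].
  have n0 : (0 : R) < n.+1%:R^-1 by rewrite invr_gt0.
  by have [_ [y [Qy Cy ty tyx ->]] h] := aW _ n0; exists y.
have [f hf] := choice ex.
have Mf n : M (f n) by have [[]] := hf n.
have Cf n l : hn (rho (f n) l) <= C * hn l by have [_ ->] := hf n.
have fk (e : R) : 0 < e -> exists m, forall n, (m <= n)%N -> hn (rho (f n) Om - k) < e.
  move=> e0; have [m hm] := invS_lt e0; exists m => n mn.
  by have [_ _ _ _ h] := hf n; exact: lt_trans h (hm _ mn).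
have C0 : 0 <= `|C| by [].
have bf m n l : hn (rho (f m) l - rho (f n) l) <= 2 * `|C| * hn l.
  have := Cf m l; have := Cf n l; have := ler_hnD (rho (f m) l) (- rho (f n) l).
  by rewrite hnN; have := ler_norm C; have := hn_ge0 l; nra.
have cv l : exists k', slim (fun n => rho (f n) l) k'.
  apply: hilbert_complete => e e0.
  have d0 : 0 < 2 * `|C| + 1 by rewrite ltr_wpDl // mulr_ge0.
  have e2 : 0 < e / 2 by rewrite divr_gt0.
  have [_ [a Ma <-] ha] := gns_dense gM l (divr_gt0 e2 d0).
  have [B B0 hB] := gns_right_bound Ma.
  have [m0 hm] := fk _ (divr_gt0 (divr_gt0 e2 (ltr0Sn _ 1)) B0).
  exists m0 => m n mm nn.
  have Md : M (fun v => f m v - f n v) by exact: oa_sub.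
  have h1 := hB _ Md; rewrite !(rho_sub iM) // in h1.
  have h2 := ler_hn_dist k (rho (f m) Om) (rho (f n) Om).
  have := hm _ mm; have := hm _ nn; rewrite !ltr_pdivlMr // => h3 h4.
  rewrite (hn_distC k) in h2.
  have h5 := bf m n (l - rho a Om).
  move: ha; rewrite ltr_pdivlMr // hn_distC => ha.
  have -> : rho (f m) l - rho (f n) l = (rho (f m) (rho a Om) - rho (f n) (rho a Om)) +
      (rho (f m) (l - rho a Om) - rho (f n) (l - rho a Om)).
    rewrite (linB (rho_linear iM (Mf m))) (linB (rho_linear iM (Mf n))) subrACA.
    by rewrite [RHS]addrC subrK.
  apply: le_lt_trans (ler_hnD _ _) _.
  have h6 := ler_wpM2l (ltW B0) h2; have := hn_ge0 (l - rho a Om).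
  move: h1 h3 h4 h5 h6 ha; rewrite mulrDr.
  move: (hn _) (hn _) (hn _) (hn _) (hn _) (hn _) => a1 a2 a3 a4 a5 a6.
  lra.
have [L hL] := choice cv.
have lin_lim (B : R) (hS : 0 < B) : forall l l' : K,
    (forall e : R, 0 < e -> hn (l - l') <= B * e) -> l = l'.
  move=> l l' h; apply/eqP; rewrite -subr_eq0; apply/eqP/hn_eq0/eqP.
  rewrite eq_le hn_ge0 andbT; apply: le_eps0 => e e0.
  have := h _ (divr_gt0 e0 hS); rewrite mulrC divfK //; exact: lt0r_neq0.
have lim2 l l' (e : R) : 0 < e -> exists n,
    hn (rho (f n) l - L l) < e /\ hn (rho (f n) l' - L l') < e.
  move=> e0; have [n1 h1] := hL l _ e0; have [n2 h2] := hL l' _ e0.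
  exists (maxn n1 n2); split; [apply: h1|apply: h2]; by rewrite ?leq_maxl ?leq_maxr.
have LL : linear L.
  move=> c u v. apply: (lin_lim (rnorm c + 2)) => [|e e0].
    by rewrite ltr_wpDl ?rnorm_ge0.
  have [n1 h1] := hL (c *: u + v) _ e0; have [n2 h2] := hL u _ e0.
  have [n3 h3] := hL v _ e0; pose n := maxn n1 (maxn n2 n3).
  have := h1 n (leq_maxl _ _).
  have := h2 n (leq_trans (leq_maxl _ _) (leq_maxr _ _)).
  have := h3 n (leq_trans (leq_maxr _ _) (leq_maxr _ _)).
  rewrite (rho_linear iM (Mf n)).
  set a := rho _ u; set b := rho _ v => hb ha hc.
  have := ler_hn_dist (c *: a + b) (L (c *: u + v)) (c *: L u + L v).
  have -> : c *: a + b - (c *: L u + L v) = c *: (a - L u) + (b - L v).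
    by rewrite opprD addrACA scalerBr.
  have := ler_hnD (c *: (a - L u)) (b - L v); rewrite hnZ hn_distC in hc *.
  have := rnorm_ge0 c; nra.
have bL : bounded_op L.
  apply/bounded_opP; split=> //; exists C => l; rewrite -subr_le0.
  apply: le_eps0 => e e0; have [n [h _]] := lim2 l l _ e0.
  have := Cf n l; have := ler_hn_dist (rho (f n) l) (L l) 0.
  by rewrite !subr0 (hn_distC (L l)); lra.
have comL (S : K -> K) : bounded_op S ->
    (forall n l, rho (f n) (S l) = S (rho (f n) l)) -> forall l, L (S l) = S (L l).
  move=> bS cS l; have [B B0 hB] := bounded_opC bS.
  apply: (lin_lim (1 + B)) => [|e e0]; first by rewrite addr_gt0.
  have [n [h1 h2]] := lim2 (S l) l _ e0.
  have := ler_hn_dist (rho (f n) (S l)) (L (S l)) (S (L l)).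
  rewrite {2}cS -(linB (bounded_lin bS)) (hn_distC (L (S l)) (rho _ _)).
  by have := hB (rho (f n) l - L l); have := ler_wpM2l (ltW B0) (ltW h2); lra.
have [y My yL] : (rho @` M) L.
  have [_ <-] := vni_range iM; split=> // S [bS cS].
  apply/funext => l /=; apply: comL => // n l'.
  have := cS (rho (f n)); move=> /(_ (ex_intro2 _ _ (f n) (Mf n) erefl)) h.
  exact: (congr1 (@^~ l') (esym h)).
have Qy : Q y.
  split=> //; rewrite yL; split=> // S DS; apply/funext => l /=; apply: comL.
    exact: bD.
  by move=> n l'; have [[_ c] _ _ _ _] := hf n; exact: commutantP c DS.
have kL : k = L Om.
  apply: (lin_lim 2) => [//|e e0].
  have [n1 h1] := hL Om _ e0; have [n2 h2] := fk _ e0; pose n := maxn n1 n2.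
  have := h1 n (leq_maxl _ _); have := h2 n (leq_maxr _ _).
  have := ler_hn_dist (rho (f n) Om) k (L Om); rewrite (hn_distC k (rho _ _)); lra.
have Md n : M (fun v => y v - f n v) by exact: oa_sub.
have small (e : R) : 0 < e -> exists n, hn (rho (fun v => y v - f n v) Om) < e.
  move=> e0; have [n [h _]] := lim2 Om Om _ e0; exists n.
  by rewrite (rho_sub iM) // yL hn_distC.
exists y; split=> //.
- move=> l; rewrite yL -subr_le0; apply: le_eps0 => e e0.
  have [n [h _]] := lim2 l l _ e0.
  have := Cf n l; have := ler_hn_dist (rho (f n) l) (L l) 0.
  by rewrite !subr0 (hn_distC (L l)); lra.
- apply/eqP; rewrite -subr_eq0; apply/eqP/rnorm_eq0/eqP; rewrite eq_le rnorm_ge0 andbT.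
  apply: le_eps0 => e e0.
  have d0 : 0 < hn Om + 1 by rewrite ltr_wpDl ?hn_ge0.
  have [n h] := small _ (divr_gt0 e0 d0); have [_ _ <- _ _] := hf n.
  rewrite -(trB tM2 (sM My) (sM (Mf n))) (le_trans (gns_tr_bound (Md n))) //.
  move: h; rewrite ltr_pdivlMr //; have := hn_ge0 Om.
  by have := hn_ge0 (rho (fun v => y v - f n v) Om); nra.
- apply/eqP; rewrite -subr_eq0; apply/eqP/rnorm_eq0/eqP; rewrite eq_le rnorm_ge0 andbT.
  apply: le_eps0 => e e0; have [B B0 hB] := gns_tr_comp_bound.
  have [n h] := small _ (divr_gt0 e0 B0); have [_ _ _ <- _] := hf n.
  rewrite -(trB tM2 (oa_comp aM2 (sM My) Mx) (oa_comp aM2 (sM (Mf n)) Mx)).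
  rewrite (le_trans (hB _ (Md n))) //.
  by move: h; rewrite ltr_pdivlMr // mulrC; exact: ltW.
- by rewrite yL.
Qed.

Let W_mid k l : W k -> W l -> W ((2^-1 : R[i]) *: (k + l)).
Proof.
move=> [y [Qy Cy ty tyx ->]] [z [Qz Cz tz tzx ->]].
(* The bracket is half of [z], written through combinations [c S + T], the form in which linearity
   is available. *)
pose m := fun v => (2^-1 : R[i]) *: y v + (- 2^-1 *: z v + z v).
have Qzz := Q_lin (- 2^-1) Qz Qz.
have Qm : Q m := Q_lin 2^-1 Qy Qzz.
have rm l' : rho m l' = (2^-1 : R[i]) *: (rho y l' + rho z l').
  rewrite /m (vni_linear iM _ Qy.1 Qzz.1) (vni_linear iM _ Qz.1 Qz.1).
  rewrite scalerDr; congr (_ + _).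
  rewrite -{2}[rho z l']scale1r -scalerDl; congr (_ *: _); by field.
exists m; split=> //.
- move=> l'; rewrite rm hnZ rnorm_half.
  by have := ler_hnD (rho y l') (rho z l'); have := Cy l'; have := Cz l'; lra.
- rewrite /m (ntr_linear tM2 _ (sM Qy.1) (sM Qzz.1)).
  by rewrite (ntr_linear tM2 _ (sM Qz.1) (sM Qz.1)) ty tz; field.
- have Y := oa_comp aM2 (sM Qy.1) Mx; have Z := oa_comp aM2 (sM Qz.1) Mx.
  transitivity (t (fun v => (2^-1 : R[i]) *: (y \o x) v +
    (fun v => - 2^-1 *: (z \o x) v + (z \o x) v) v)); first by [].
  rewrite (ntr_linear tM2 _ Y (oa_lin aM2 (- 2^-1) Z Z)).
  by rewrite (ntr_linear tM2 _ Z Z) tyx tzx; field.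
Qed.

Hypotheses (vN : von_neumann N) (sN : N `<=` M).
Hypothesis DN : forall T, N T -> commutant D (rho T).
Hypothesis cx : forall a, N a -> a \o x = x \o a.

(** Traciality cancels [u] against [u'] in both traces, in the second one because [x] commutes with
    [u']. For the norm, the right factor [u'] becomes a left factor after passing to the adjoint. *)
Let W_conj u u' : N u -> N u' -> adjoint u u' -> u \o u' = id -> u' \o u = id ->
  forall y, [/\ Q y, forall k, hn (rho y k) <= C * hn k,
    t y = t y0 & t (y \o x) = t (y0 \o x)] ->
  W (rho (u \o y \o u') Om) /\ hn (rho (u \o y \o u') Om) = hn (rho y Om).
Proof.
move=> Nu Nu' auu' uu' u'u y [Qy Cy ty tyx].
have Mu := sN Nu; have Mu' := sN Nu'; have [My Dy] := Qy.
have Muy := oa_comp aM Mu My; have Muyu := oa_comp aM Muy Mu'.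
have xu' v : u' (x v) = x (u' v) by exact: (congr1 (@^~ v) (cx Nu')).
have u'uE v : u' (u v) = v by exact: (congr1 (@^~ v) u'u).
have iso v v' : N v -> N v' -> adjoint v v' -> v' \o v = id ->
    forall k, hn (rho v k) = hn k.
  move=> Nv Nv' avv' v'v k; have := vni_star iM (sN Nv) (sN Nv') avv'.
  move=> a; have : hn (rho v k) ^+ 2 = hn k ^+ 2.
    by rewrite !hn_sqr a -(rho_comp iM) ?v'v ?(vni_id iM) //; exact: sN.
  by move=> /eqP; rewrite eqrXn2 ?hn_ge0 // => /eqP.
have rE k : rho (u \o y \o u') k = rho u (rho y (rho u' k)).
  by rewrite (rho_comp iM _ Muy Mu') (rho_comp iM _ Mu My).
split.
  exists (u \o y \o u'); split=> //.
  - split=> //; rewrite (vni_mul iM Muy Mu') (vni_mul iM Mu My).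
    by apply: commutant_comp; [apply: commutant_comp => //|]; exact: DN.
  - move=> k; rewrite rE (iso u u') // (le_trans (Cy _)) //.
    by rewrite (iso u' u) //; exact: adjoint_sym.
  - rewrite (ntr_comm tM2 (sM Muy) (sM Mu')) -ty.
    by congr t; apply/funext => v /=; rewrite u'uE.
  - have Yx := oa_comp aM2 (sM My) Mx.
    transitivity (t (u \o (y \o x \o u'))).
      by congr t; apply/funext => v /=; rewrite xu'.
    rewrite (ntr_comm tM2 (sM Mu) (oa_comp aM2 Yx (sM Mu'))) -tyx.
    by congr t; apply/funext => v /=; rewrite u'uE.
have [y' My' ay] := oa_adj aM My.
rewrite rE (iso u u') // -(rho_comp iM _ My Mu').
rewrite (gns_star (oa_comp aM My Mu') (adjoint_comp ay (adjoint_sym auu'))).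
by rewrite (rho_comp iM _ Mu My') (iso u u') // -(gns_star My ay).
Qed.

Hypothesis Qy0 : Q y0.
Hypothesis Cy0 : forall k, hn (rho y0 k) <= C * hn k.

(* The minimal-norm vector of W is fixed under conjugation by unitaries of N,
   in particular by the Cayley transforms of skew-adjoint elements of N. *)
Let averaged : exists y, [/\ Q y, t y = t y0, t (y \o x) = t (y0 \o x) &
  forall a, N a -> y \o a = a \o y].
Proof.
have aN := von_neumann_opalg vN.
have W0 : W (rho y0 Om) by exists y0.
have [k [y [Qy Cy ty tyx ->]] kmin] := convex_min W0 W_mid W_closed.
exists y; split=> //.
have [My Dy] := Qy.
have skew T : N T -> (forall v w, ip H (T v) w = - ip H v (T w)) -> y \o T = T \o y.
  move=> NT sT; have bT := oa_bounded aN NT; have lT := bounded_lin bT.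
  have [b [bb b1 b2]] := skew_resolvent bT sT.
  have NTm : N (fun v => -1 *: T v) by exact: oa_scale.
  have sTm v w : ip H (-1 *: T v) w = - ip H v (-1 *: T w).
    by rewrite ipZl ipZr sT rmorphN rmorph1; ring.
  have [c [bc c1 c2]] := skew_resolvent (oa_bounded aN NTm) sTm.
  (* A resolvent commutes with everything that commutes with [S], so the bicommutant property places
     it in [N]. *)
  have Nres (S d : H -> H) : N S -> bounded_op d -> (forall w, d w - S (d w) = w) ->
      (forall w, d (w - S w) = w) -> N d.
    move=> NS bd d1 d2; rewrite -vN.2; split=> // U cU.
    have lU := bounded_lin cU.1.
    have e v : U v = U (d v) - S (U (d v)).
      by rewrite -{1}(d1 v) (linB lU) (commutantP _ cU NS).
    by apply/funext => v /=; rewrite e d2.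
  have Nb := Nres _ _ NT bb b1 b2; have Nc := Nres _ _ NTm bc c1 c2.
  have {}c1 w : c w + T (c w) = w by rewrite -{3}(c1 w) scaleN1r opprK.
  have {}c2 w : c (w + T w) = w by rewrite -{3}(c2 w) scaleN1r opprK.
  (* [u] is [(1 + T) (1 - T)^-1 = 2 (1 - T)^-1 - 1], and [u'] is the same expression for [- T].
     Commuting with [u] therefore means commuting with the resolvent [b], hence with [T]. *)
  pose u := fun w => b w + T (b w); pose u' := fun w => c w - T (c w).
  have uE w : u w = 2 *: b w - w.
    have Tb : T (b w) = b w - w by rewrite -{3}(b1 w) subKr.
    by rewrite /u Tb scaler_nat mulr2n addrA.
  have Nu : N u.
    have := oa_lin aN 1 Nb (oa_comp aN NT Nb); congr (N _); apply/funext => w.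
    by rewrite scale1r.
  have Nu' : N u' by exact: (oa_sub aN Nc (oa_comp aN NT Nc)).
  have uu' w : u (u' w) = w by rewrite /u /u' b2 c1.
  have u'u w : u' (u w) = w by rewrite /u /u' c2 b1.
  have auu' : adjoint u u'.
    move=> v w; rewrite -[in RHS](b1 v) ipBl sT opprK -ipDr /u ipDl sT -ipBr.
    congr (ip H _ _); rewrite /u' (linB lT) [RHS]addrA subrK.
    by rewrite -{1 2}(c1 w) (linD lT) opprD addrA addrK.
  have [Wuyu nuyu] := W_conj Nu Nu' auu' (funext uu') (funext u'u)
    (And4 Qy Cy ty tyx).
  have Wy : W (rho y Om) by exists y.
  have Muyu : M (u \o y \o u') by apply: (oa_comp aM) (sN Nu'); exact: (oa_comp aM (sN Nu)).
  have yu w : y (u w) = u (y w).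
    have := gns_inj My Muyu (convex_min_uniq W_mid Wy Wuyu kmin nuyu).
    by move=> /(congr1 (fun f => f (u w))) /= ->; rewrite u'u.
  have yb w : y (b w) = b (y w).
    have := yu w; rewrite !uE (linB (oa_linear aM My)) (linZ (oa_linear aM My)).
    by move=> /addIr /(scalerI _); apply; rewrite pnatr_eq0.
  have binj v w : b v = b w -> v = w.
    by move=> h; rewrite -(b1 v) -(b1 w) h.
  apply/funext => w /=.
  have : y (w - T w) = y w - T (y w) by apply: binj; rewrite -yb !b2.
  by rewrite (linB (oa_linear aM My)) => /addrI /oppr_inj.
move=> a Na; have [a' Na' aa] := oa_adj aN Na.
have ly := oa_linear aM My.
(* A general [a] is recovered from the two skew-adjoint elements [a - a'] and ['i (a + a')]. *)
have h1 : y \o (fun w => a w - a' w) = (fun w => a w - a' w) \o y.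
  apply: skew => [|v w]; first exact: oa_sub.
  by rewrite ipBl ipBr aa (adjoint_sym aa) opprB.
have h2 : y \o (fun w => 'i *: (a w + a' w)) = (fun w => 'i *: (a w + a' w)) \o y.
  apply: skew => [|v w].
    apply: (oa_scale aN); have := oa_lin aN 1 Na Na'; congr (N _).
    by apply/funext => w; rewrite scale1r.
  rewrite ipZl ipZr ipDl ipDr aa (adjoint_sym aa) conjCi mulNr opprK addrC //.
apply/funext => w /=.
have {}h1 := congr1 (@^~ w) h1; have {}h2 := congr1 (@^~ w) h2.
move: h1 h2; rewrite /= (linB ly) (linZ ly) (linD ly) => h1.
move=> /(scalerI (neq0Ci _)) h2.
have : (2 : R[i]) *: y (a w) = 2 *: a (y w).
  have e (p q : H) : (2 : R[i]) *: p = (p - q) + (p + q).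
    by rewrite addrACA addNr addr0 scaler_nat mulr2n.
  by rewrite (e _ (y (a' w))) h1 h2 -e.
by apply: scalerI; rewrite pnatr_eq0.
Qed.

Hypothesis hQ : forall y, Q y -> (forall a, N a -> y \o a = a \o y) ->
  exists c : R[i], y = (fun v => c *: v).

Lemma averaged_trace : t (y0 \o x) = t y0 * t x.
Proof.
have [y [Qy <- <- cy]] := averaged; have [c ->] := hQ Qy cy.
have -> : (fun v => c *: v) \o x = (fun v => c *: x v) by [].
rewrite (trZ aM2 tM2 _ Mx) (trZ aM2 tM2 _ (oa_id aM2)) (ntr_id tM2).
by rewrite mulr1.
Qed.
End Averaging.

(** Replacing [y] by its average changes neither trace, and the average is a scalar. The three uses
    are [y] in [N] against [N' /\ M], [y] in [M] against [e1], both averaged over [N], and [y] in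
    [M1] against [e2], averaged over [M]. *)
Lemma trace_factorizes (R : realType) (H K : hilbertSpace R)
    (N M M2 : set (H -> H)) (t : (H -> H) -> R[i]) (rho : (H -> H) -> K -> K)
    (Om : K) (D : set (K -> K)) (x : H -> H) :
  opalg M -> opalg M2 -> normalized_trace M2 t -> M `<=` M2 -> gns M t rho Om ->
  (forall S, D S -> bounded_op S) ->
  von_neumann N -> N `<=` M -> (forall T, N T -> commutant D (rho T)) ->
  (forall y, M y -> commutant D (rho y) -> (forall a, N a -> y \o a = a \o y) ->
    exists c : R[i], y = (fun v => c *: v)) ->
  M2 x -> (forall a, N a -> a \o x = x \o a) ->
  forall y, M y -> commutant D (rho y) -> t (y \o x) = t y * t x.
Proof.
move=> aM aM2 tM2 sM gM bD vN sN DN hQ Mx cx y My Dy.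
have [C _ hC] := bounded_opC (rho_bounded (gns_iso gM) My).
apply: (averaged_trace aM aM2 tM2 sM gM Mx bD vN sN DN cx _ hC) => //.
by move=> z [Mz Dz]; exact: hQ.
Qed.

(** * The basic construction and the Jones tower *)

Lemma ip_adherent0 (R : realType) (H : hilbertSpace R) (A : set H) u v :
  (forall a, A a -> ip H u a = 0) -> adherent A v -> ip H u v = 0.
Proof.
move=> uA av; apply/rnorm_eq0/eqP; rewrite eq_le rnorm_ge0 andbT.
apply: le_eps0 => e e0; have d0 : 0 < hn u + 1 by rewrite ltr_wpDl ?hn_ge0.
have [a Aa ha] := av _ (divr_gt0 e0 d0).
have -> : ip H u v = ip H u (v - a) by rewrite ipBr (uA a Aa) subr0.
rewrite (le_trans (cauchy_schwarz _ _)) // hn_distC.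
by move: ha; rewrite ltr_pdivlMr //; have := hn_ge0 u; have := hn_ge0 (a - v); nra.
Qed.

Lemma adherent_fix (R : realType) (H : hilbertSpace R) (A : set H) (S T : H -> H) :
  bounded_op S -> bounded_op T -> (forall a, A a -> S a = T a) ->
  forall v, adherent A v -> S v = T v.
Proof.
move=> bS bT ST v av.
pose U : H -> H := fun v => -1 *: T v + S v.
have bU : bounded_op U by exact: bounded_comb.
suff : adherent [set 0] (U v).
  move=> h; apply/eqP; rewrite -subr_eq0 addrC -scaleN1r; apply/eqP/hn_eq0/eqP.
  rewrite eq_le hn_ge0 andbT; apply: le_eps0 => e /h [_ -> h'].
  by apply: ltW; move: h'; rewrite sub0r hnN.
apply: adherent_map bU _ v av => a Aa e e0; exists 0 => //.
by rewrite /U ST // scaleN1r addNr subrr hn0.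
Qed.

Lemma image_subspace (R : realType) (H K : hilbertSpace R) (M N : set (H -> H))
    (rho : (H -> H) -> K -> K) Om :
  opalg M -> opalg N -> N `<=` M -> vn_isomorphism M rho ->
  subspace [set rho T Om | T in N].
Proof.
move=> aM aN sN iM; split.
  by exists (fun=> 0); [exact: oa_zero|rewrite (rho_zero aM iM)].
move=> c _ _ [S NS <-] [T NT <-]; exists (fun v => c *: S v + T v).
  exact: oa_lin.
by rewrite (vni_linear iM) //; exact: sN.
Qed.

Section BasicConstruction.
Context {R : realType} {H K : hilbertSpace R}.
Variables (N M M1 : set (H -> H)) (e : H -> H) (t : (H -> H) -> R[i]).
Variables (rho : (H -> H) -> K -> K) (Om : K).
Hypotheses (aN : opalg N) (aM : opalg M) (aM1 : opalg M1).
Hypotheses (sN : N `<=` M) (sM : M `<=` M1) (M1e : M1 e).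
Hypotheses (iM1 : vn_isomorphism M1 rho) (gM : gns M t rho Om).
Hypothesis pe :
  orthogonal_projection (cyclic_subspace (rho @` N) Om) (rho e).

Let V := [set rho T Om | T in N].

Lemma bc_proj : orthogonal_projection (adherent V) (rho e).
Proof. by rewrite /V -cyclicE. Qed.
Lemma bc_subspace : subspace (adherent V).
Proof.
by apply: adherent_subspace; exact: (image_subspace _ aM aN sN (gns_iso gM)).
Qed.
Lemma bc_in T : N T -> adherent V (rho T Om).
Proof. by move=> NT d d0; exists (rho T Om); [exists T|rewrite subrr hn0]. Qed.

Lemma bc_fix T : N T -> rho e (rho T Om) = rho T Om.
Proof. by move=> NT; apply: (proj_fix bc_subspace bc_proj); exact: bc_in. Qed.
Lemma bc_Om : rho e Om = Om.
Proof. by have := bc_fix (oa_id aN); rewrite (vni_id iM1). Qed.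

Lemma bc_adj : adjoint e e.
Proof.
have [f M1f aef] := oa_adj aM1 M1e.
suff fe : f = e by rewrite -{2}fe.
apply: (vni_inj iM1 M1f M1e).
exact: adjoint_uniq (vni_star iM1 M1e M1f aef) (proj_adj bc_proj).
Qed.
Lemma bc_idem v : e (e v) = e v.
Proof.
suff : e \o e = e by move=> h; exact: (congr1 (@^~ v) h).
apply: (vni_inj iM1 (oa_comp aM1 M1e M1e) M1e).
rewrite (vni_mul iM1 M1e M1e); apply/funext => k /=; apply: (proj_fix bc_subspace bc_proj).
exact: (proj_in bc_proj _).
Qed.

(** Invariance under [S'] makes the orthogonal complement of [W] invariant under [S]. *)
Lemma proj_commute (W : set K) P S S' : subspace W -> orthogonal_projection W P ->
  linear S -> adjoint S S' -> (forall w, W w -> W (S w)) ->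
  (forall w, W w -> W (S' w)) -> P \o S = S \o P.
Proof.
move=> sW pP lS aS WS WS'; apply/funext => k /=.
apply: (proj_uniq sW pP); first by apply: WS; exact: (proj_in pP _).
by move=> w Ww; rewrite -(linB lS) aS (pP k).2 //; exact: WS'.
Qed.

Lemma bc_invariant T v : N T -> adherent V v -> adherent V (rho T v).
Proof.
move=> NT; have MT := sM (sN NT).
apply: (adherent_map (rho_bounded iM1 MT)) => _ [S NS <-].
rewrite -(rho_comp iM1 _ MT (sM (sN NS))); apply: bc_in; exact: oa_comp.
Qed.

Lemma bc_commute T : N T -> e \o T = T \o e.
Proof.
move=> NT; have MT := sM (sN NT); have [T' NT' aT] := oa_adj aN NT.
have MT' := sM (sN NT').
apply: (vni_inj iM1 (oa_comp aM1 M1e MT) (oa_comp aM1 MT M1e)).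
rewrite (vni_mul iM1 M1e MT) (vni_mul iM1 MT M1e).
apply: (proj_commute bc_subspace bc_proj (rho_linear iM1 MT)
  (vni_star iM1 MT MT' aT)) => w; exact: bc_invariant.
Qed.

Lemma bc_neq0 : t id = 1 -> e = (fun=> 0) -> False.
Proof.
move=> t1 e0; have := bc_Om; rewrite e0 (rho_zero aM1 iM1) => O0.
have := gns_state gM (oa_id aM); rewrite t1 (vni_id iM1) -O0 ip0l.
by move=> /eqP; rewrite eq_sym oner_eq0.
Qed.
End BasicConstruction.

(** * Relative commutants and the Markov property in the tower *)

Section TowerTrace.
Context {R : realType} {H : hilbertSpace R}.
Variables (N M M1 M2 : set (H -> H)) (e1 e2 : H -> H) (t : (H -> H) -> R[i]).
Variable delta : R.
Hypothesis jt : jones_tower N M M1 M2 e1 e2 t delta.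

Lemma jt_vN : [/\ von_neumann N, von_neumann M, von_neumann M1 & von_neumann M2].
Proof. by case: jt => [[[? _] _ _] [[? _] _ _] [[? _] _ _] [[? _] _ _]]. Qed.
Lemma jt_opalg : [/\ opalg N, opalg M, opalg M1 & opalg M2].
Proof. by have [*] := jt_vN; split; exact: von_neumann_opalg. Qed.
Lemma jt_sub : [/\ N `<=` M, M `<=` M1 & M1 `<=` M2].
Proof. by case: jt => _ _ _ _ ? [? _ _] [? _ _]. Qed.
Lemma jt_trace : normalized_trace M2 t.
Proof. by case: jt => _ _ _ []. Qed.

Let aN : opalg N. Proof. by have [] := jt_opalg. Qed.
Let aM : opalg M. Proof. by have [] := jt_opalg. Qed.
Let aM1 : opalg M1. Proof. by have [] := jt_opalg. Qed.
Let aM2 : opalg M2. Proof. by have [] := jt_opalg. Qed.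
Let sN : N `<=` M. Proof. by have [] := jt_sub. Qed.
Let sM : M `<=` M1. Proof. by have [] := jt_sub. Qed.
Let sM1 : M1 `<=` M2. Proof. by have [] := jt_sub. Qed.
Let sMM2 : M `<=` M2. Proof. by move=> T /sM /sM1. Qed.
Let tM2 := jt_trace.
Let vN : von_neumann N. Proof. by have [] := jt_vN. Qed.
Let vM : von_neumann M. Proof. by have [] := jt_vN. Qed.

Hypothesis abelian : forall x y, relcomm N M1 x -> relcomm N M1 y -> x \o y = y \o x.

(** Averaging [n] over [N] inside the bicommutant of [rho @] N[produces a central element. It is
    scalar because the index hypothesis makes the commutant of]rho @[N] a factor. *)
Lemma trace_N n p : N n -> relcomm N M p -> t (n \o p) = t n * t p.
Proof.
move=> Nn [cp Mp].
have [K [rho [Om [t' [_ [_ [_ /= [gM [[vN' fN'] _ _] _ _ _]]]]]]]] := jt_index jt.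
have iM := gns_iso gM.
have bN S : (rho @` N) S -> bounded_op S.
  by move=> [T NT <-]; exact: (rho_bounded iM (sN NT)).
apply: (@trace_factorizes _ _ _ N M M2 t rho Om (commutant (rho @` N)) p) => //.
- by move=> S [].
- by move=> T NT; apply: commutant_mem => //; exists T.
- move=> y My Dy yN; have [|c rc] := fN' (rho y) _ Dy.
    split; first exact: (rho_bounded iM My).
    move=> _ [T NT <-].
    by rewrite -(vni_mul iM My (sN NT)) -(vni_mul iM (sN NT) My) yN.
  exists c; apply: (vni_inj iM) => //; first exact: (oa_scale aM c (oa_id aM)).
  by rewrite rc (rho_scale aM iM c (oa_id aM)) (vni_id iM).
- exact: sMM2.
- by move=> a Na; have [_ h] := cp; rewrite h.
- exact: sN.
- by apply: commutant_mem => //; exists n.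
Qed.

(** Since [p] commutes with [e1], the vector [p Om = e1 p Om] lies in the closure of [N Om]; by
    [trace_N] its difference from [t p *: Om] is orthogonal to that closure. *)
Lemma relcomm_NM p : relcomm N M p -> p = (fun v => t p *: v).
Proof.
move=> [cp Mp].
have [_ M1e [K [rho [Om [iM1 gM pe _]]]]] := jt_basic1 jt.
have iM := gns_iso gM.
have pN := bc_proj pe.
have sV := bc_subspace aN aM sN gM.
have e1N : relcomm N M1 e1.
  split=> //; split; first exact: (oa_bounded aM1 M1e).
  by move=> T NT; exact: (bc_commute aN aM aM1 sN sM M1e iM1 gM pe NT).
have pe1 := abelian (conj cp (sM Mp)) e1N.
have pV : adherent [set rho T Om | T in N] (rho p Om).
  have -> : rho p Om = rho e1 (rho p Om).
    rewrite -{1}(bc_Om aN aM sN iM1 gM pe) -(rho_comp iM1 _ (sM Mp) M1e) pe1.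
    by rewrite (rho_comp iM1 _ M1e (sM Mp)).
  exact: (proj_in pN _).
pose w := rho p Om - t p *: Om.
have OV : adherent [set rho T Om | T in N] Om.
  by have := bc_in rho Om (oa_id aN); rewrite (vni_id iM).
have wV : adherent [set rho T Om | T in N] w.
  exact: (subspaceB sV pV (subspaceZ _ sV OV)).
have w0 : w = 0.
  apply: ip_eq0; apply: ip_adherent0 wV => _ [T NT <-].
  have [T' NT' aT] := oa_adj aN NT.
  rewrite ipBl ipZl (gns_ip aM iM gM Mp (sN NT) aT) (trace_N NT') //.
  have := gns_ip aM iM gM (oa_id aM) (sN NT) aT; rewrite (vni_id iM) => ->.
  by rewrite mulrC subrr.
have Mt : M (fun v => t p *: v) by exact: (oa_scale aM _ (oa_id aM)).
apply: (gns_inj aM tM2 sMM2 gM Mp Mt).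
rewrite (rho_scale aM iM _ (oa_id aM)) (vni_id iM).
by apply/eqP; rewrite -subr_eq0 -/w w0.
Qed.

Lemma trace_e1 m : M m -> t (m \o e1) = t m * t e1.
Proof.
move=> Mm.
have [_ M1e [K [rho [Om [iM1 gM pe _]]]]] := jt_basic1 jt.
have iM := gns_iso gM.
have bM S : (rho @` M) S -> bounded_op S.
  by move=> [T MT <-]; exact: (rho_bounded iM MT).
apply: (@trace_factorizes _ _ _ N M M2 t rho Om (commutant (rho @` M)) e1) => //.
- by move=> S [].
- by move=> T NT; apply: commutant_mem => //; exists T => //; exact: sN.
- move=> y My _ yN; exists (t y); apply: relcomm_NM; split=> //.
  by split=> //; exact: (oa_bounded aM My).
- exact: sM1.
- by move=> a Na; rewrite (bc_commute aN aM aM1 sN sM M1e iM1 gM pe).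
- by apply: commutant_mem => //; exists m.
Qed.

(** Such a [y] also lies in [N' /\ M1], so it commutes with [e1]; as [M] and [e1] generate [M1], it
    is central in a factor. *)
Lemma relcomm_MM1 y : relcomm M M1 y -> exists c : R[i], y = (fun v => c *: v).
Proof.
move=> [[by_ cy] M1y].
have [_ M1e [K [rho [Om [iM1 gM pe dM1]]]]] := jt_basic1 jt.
have [[_ fM1] _ _] := jt_M1 jt; apply: fM1 => //; split=> // S M1S.
have e1N : relcomm N M1 e1.
  split=> //; split; first exact: (oa_bounded aM1 M1e).
  by move=> T NT; exact: (bc_commute aN aM aM1 sN sM M1e iM1 gM pe NT).
have yN : relcomm N M1 y.
  by split=> //; split=> // T NT; apply: cy; exact: sN.
have ye := abelian yN e1N.
apply: (vni_inj iM1 (oa_comp aM1 M1y M1S) (oa_comp aM1 M1S M1y)).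
rewrite (vni_mul iM1 M1y M1S) (vni_mul iM1 M1S M1y).
have : (rho @` M1) (rho S) by exists S.
rewrite dM1 => -[_ h]; rewrite h //; split; first exact: (rho_bounded iM1 M1y).
move=> U [[T MT <-]|->].
  by rewrite -(vni_mul iM1 M1y (sM MT)) -(vni_mul iM1 (sM MT) M1y) cy.
by rewrite -(vni_mul iM1 M1y M1e) -(vni_mul iM1 M1e M1y) ye.
Qed.

Lemma trace_e2 x : M1 x -> t (x \o e2) = t x * t e2.
Proof.
move=> M1x.
have [_ M2e [K [rho [Om [iM2 gM1 pe _]]]]] := jt_basic2 jt.
have iM1 := gns_iso gM1.
have bM S : (rho @` M1) S -> bounded_op S.
  by move=> [T MT <-]; exact: (rho_bounded iM1 MT).
apply: (@trace_factorizes _ _ _ M M1 M2 t rho Om (commutant (rho @` M1)) e2) => //.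
- by move=> S [].
- by move=> T NT; apply: commutant_mem => //; exists T => //; exact: sM.
- move=> y My _ yN; apply: relcomm_MM1; split=> //.
  by split=> //; exact: (oa_bounded aM1 My).
- by move=> a Na; rewrite (bc_commute aM aM1 aM2 sM sM1 M2e iM2 gM1 pe).
- by apply: commutant_mem => //; exists x.
Qed.

(** On L^2(M1), [e2] projects onto the closure of [M Om], and [trace_e1] says that [e1 m Om] has the
    projection [t e1 *: m Om]. *)
Lemma e2_e1_e2 v : e2 (e1 (e2 v)) = t e1 *: e2 v.
Proof.
have [_ M1e _] := jt_basic1 jt.
have [_ M2e [K [rho [Om [iM2 gM1 pe _]]]]] := jt_basic2 jt.
have iM1 := gns_iso gM1.
have pM := bc_proj pe; have sV := bc_subspace aM aM1 sM gM1.
suff : e2 \o (e1 \o e2) = (fun v => t e1 *: e2 v).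
  by move=> h; exact: (congr1 (@^~ v) h).
have M2e1 := sM1 M1e.
have m12 : M2 (e1 \o e2) by exact: oa_comp.
have m212 : M2 (e2 \o (e1 \o e2)) by exact: oa_comp.
apply: (vni_inj iM2) => //; first exact: oa_scale.
rewrite (rho_scale aM2 iM2) //; apply/funext => k.
rewrite (rho_comp iM2 _ M2e m12) (rho_comp iM2 _ M2e1 M2e).
have be : bounded_op (rho e2 \o rho e1).
  by apply: bounded_comp; exact: (rho_bounded iM2).
have bi : bounded_op (fun k : K => t e1 *: k + 0).
  apply: (bounded_comb (T := fun=> 0) _ bounded_id); apply/bounded_opP; split.
    by move=> c u w; rewrite scaler0 addr0.
  by exists 0 => u; rewrite hn0 mul0r.
have := @adherent_fix _ _ [set rho T Om | T in M] _ _ be bi.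
rewrite -[X in _ = X]addr0; apply; last exact: (proj_in pM _).
move=> _ [m Mm <-] /=; rewrite addr0; apply: (proj_uniq sV pM).
  exact: (subspaceZ _ sV (bc_in _ _ Mm)).
move=> w; apply: ip_adherent0 => _ [m1 Mm1 <-].
have [m1' Mm1' am1] := oa_adj aM Mm1.
have M1m := sM Mm; have M1m1 := sM Mm1.
rewrite -(rho_comp iM2 _ M2e1 (sM1 M1m)) ipBl ipZl.
rewrite (gns_ip aM1 iM1 gM1 (oa_comp aM1 M1e M1m) M1m1 am1).
rewrite (gns_ip aM1 iM1 gM1 M1m M1m1 am1).
have -> : t (m1' \o (e1 \o m)) = t ((m \o m1') \o e1).
  exact: (ntr_comm tM2 (oa_comp aM2 (sMM2 Mm1') M2e1) (sMM2 Mm)).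
rewrite trace_e1; last exact: oa_comp.
by rewrite (ntr_comm tM2 (sMM2 Mm1') (sMM2 Mm)) mulrC subrr.
Qed.
End TowerTrace.

(** * The string Fourier transform *)

Section Fourier.
Context {R : realType} {H : hilbertSpace R}.
Variables (N M M1 M2 : set (H -> H)) (e1 e2 : H -> H) (t : (H -> H) -> R[i]).
Variables (delta : R) (E : (H -> H) -> (H -> H)).
Hypothesis jt : jones_tower N M M1 M2 e1 e2 t delta.
Hypothesis abelian : forall x y, relcomm N M1 x -> relcomm N M1 y -> x \o y = y \o x.
Hypothesis hE : conditional_expectation (relcomm N M2) (relcomm M M2) t E.

Let Fs := string_fourier delta E e1 e2.
Let d : R[i] := real_complex R delta.

Hypothesis Fs_isometry : forall x y y' z', relcomm N M1 x -> relcomm N M1 y ->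
  adjoint y y' -> adjoint (Fs y) z' -> t (z' \o Fs x) = t (y' \o x).
Hypothesis Fs_onto : forall z, relcomm M M2 z -> exists2 x, relcomm N M1 x & Fs x = z.

Let aN : opalg N. Proof. by have [] := jt_opalg jt. Qed.
Let aM : opalg M. Proof. by have [] := jt_opalg jt. Qed.
Let aM1 : opalg M1. Proof. by have [] := jt_opalg jt. Qed.
Let aM2 : opalg M2. Proof. by have [] := jt_opalg jt. Qed.
Let sN : N `<=` M. Proof. by have [] := jt_sub jt. Qed.
Let sM : M `<=` M1. Proof. by have [] := jt_sub jt. Qed.
Let sM1 : M1 `<=` M2. Proof. by have [] := jt_sub jt. Qed.
Let tM2 := jt_trace jt.
Let aP : opalg (relcomm N M1). Proof. exact: relcomm_opalg. Qed.
Let aQ : opalg (relcomm M M2). Proof. exact: relcomm_opalg. Qed.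

Lemma e1_props : [/\ M1 e1, adjoint e1 e1, forall v, e1 (e1 v) = e1 v,
  (forall T, N T -> e1 \o T = T \o e1) & e1 <> (fun=> 0)].
Proof.
have [_ M1e [K [rho [Om [iM1 gM pe _]]]]] := jt_basic1 jt.
split=> //.
- exact: (bc_adj aM1 M1e iM1 pe).
- exact: (bc_idem aN aM aM1 sN M1e iM1 gM pe).
- exact: (bc_commute aN aM aM1 sN sM M1e iM1 gM pe).
- exact: (bc_neq0 aN aM aM1 sN iM1 gM pe (ntr_id tM2)).
Qed.
Lemma e2_props : [/\ M2 e2, adjoint e2 e2, forall v, e2 (e2 v) = e2 v,
  (forall T, M T -> e2 \o T = T \o e2) & e2 <> (fun=> 0)].
Proof.
have [_ M2e [K [rho [Om [iM2 gM1 pe _]]]]] := jt_basic2 jt.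
split=> //.
- exact: (bc_adj aM2 M2e iM2 pe).
- exact: (bc_idem aM aM1 aM2 sM M2e iM2 gM1 pe).
- exact: (bc_commute aM aM1 aM2 sM sM1 M2e iM2 gM1 pe).
- exact: (bc_neq0 aM aM1 aM2 sM iM2 gM1 pe (ntr_id tM2)).
Qed.

Let M1e1 : M1 e1. Proof. by have [] := e1_props. Qed.
Let ae1 : adjoint e1 e1. Proof. by have [] := e1_props. Qed.
Let e1K v : e1 (e1 v) = e1 v. Proof. by have [] := e1_props. Qed.
Let M2e2 : M2 e2. Proof. by have [] := e2_props. Qed.
Let ae2 : adjoint e2 e2. Proof. by have [] := e2_props. Qed.
Let e2K v : e2 (e2 v) = e2 v. Proof. by have [] := e2_props. Qed.
Let M2e1 : M2 e1 := sM1 M1e1.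
Let Pe1 : relcomm N M1 e1.
Proof.
by split=> //; split; [exact: (oa_bounded aM1 M1e1)|have [] := e1_props].
Qed.
Let Qe2 : relcomm M M2 e2.
Proof.
by split=> //; split; [exact: (oa_bounded aM2 M2e2)|have [] := e2_props].
Qed.

Let mu := t e1.
Let mu2 := t e2.

Let proj_tr (e : H -> H) : M2 e -> adjoint e e -> (forall v, e (e v) = e v) ->
  e <> (fun=> 0) -> 0 < t e.
Proof.
move=> Me ae eK e0; have ee : e \o e = e by exact: funext.
rewrite lt_def -{2}ee (ntr_pos tM2 Me Me ae) andbT; apply/eqP => te.
by apply: e0; apply: (ntr_faithful tM2 Me Me ae); rewrite ee.
Qed.
Let mu_gt0 : 0 < mu.
Proof. by have [_ _ _ _ h] := e1_props; exact: proj_tr. Qed.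
Let mu2_gt0 : 0 < mu2.
Proof. by have [_ _ _ _ h] := e2_props; exact: proj_tr. Qed.
Let d_gt0 : 0 < d.
Proof. by rewrite ltcR; exact: jt_delta jt. Qed.

Let trx2 x : M1 x -> t (x \o e2) = t x * mu2.
Proof. exact: (trace_e2 jt abelian). Qed.
Let e212 v : e2 (e1 (e2 v)) = mu *: e2 v.
Proof. exact: (e2_e1_e2 jt abelian). Qed.
Let trC S T : M2 S -> M2 T -> t (S \o T) = t (T \o S).
Proof. exact: (ntr_comm tM2). Qed.

Let P1 x : relcomm N M1 x -> M1 x. Proof. by case. Qed.
Let P2 x : relcomm N M1 x -> M2 x. Proof. by move=> /P1/sM1. Qed.
Let Q2 x : relcomm M M2 x -> M2 x. Proof. by case. Qed.

Let Pin x : relcomm N M1 x -> relcomm N M2 (x \o e2 \o e1).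
Proof.
move=> [cx M1x].
have a2 : opalg (relcomm N M2) by exact: relcomm_opalg.
have c2 : relcomm N M2 e2.
  by split=> //; split=> [|T NT]; [exact: Qe2.1.1|apply: Qe2.1.2; exact: sN].
have c1 : relcomm N M2 e1 by split=> //; exact: Pe1.1.
by apply: (oa_comp a2) => //; apply: (oa_comp a2) => //; split=> //; exact: sM1.
Qed.

Lemma Fs_range x : relcomm N M1 x -> relcomm M M2 (Fs x).
Proof.
by move=> Px; apply: (oa_scale aQ); apply: (ce_range hE); exact: Pin.
Qed.

(** The bimodule property moves [y] inside [E], and trace preservation then removes [E]; later
    traces of transforms are computed from this formula. *)
Lemma Fs_weak x y : relcomm N M1 x -> relcomm M M2 y ->
  t (Fs x \o y) = d ^+ 3 * t (x \o e2 \o e1 \o y).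
Proof.
move=> Px Qy; have Pi := Pin Px.
have a2 : opalg (relcomm N M2) by exact: relcomm_opalg.
have Py : relcomm N M2 y.
  by case: Qy => -[by_ cy] My; split=> //; split=> // T NT; apply: cy; exact: sN.
have e : Fs x \o y = (fun v => (d ^+ 3) *: (E (x \o e2 \o e1) \o y) v).
  by apply/funext => v; rewrite /Fs /string_fourier /= realcX.
have Qe : relcomm M M2 (E (x \o e2 \o e1)) by exact: (ce_range hE).
rewrite e (trZ aM2 tM2 _ (oa_comp aM2 (Q2 Qe) (Q2 Qy))); congr (_ * _).
rewrite -(ce_trace hE (oa_comp a2 Pi Py)).
exact: (congr1 t (esym (ce_bimodule hE (oa_id aQ) Qy Pi))).
Qed.

Let Fs_tr x : relcomm N M1 x -> t (Fs x) = d ^+ 3 * mu2 * t (e1 \o x).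
Proof.
move=> Px.
have -> : t (Fs x) = d ^+ 3 * t (x \o e2 \o e1) by exact: (Fs_weak Px (oa_id aQ)).
have Mx2 := oa_comp aM2 (P2 Px) M2e2.
rewrite (trC Mx2 M2e1) -mulrA; congr (_ * _); rewrite mulrC.
exact: (trx2 (oa_comp aM1 M1e1 (P1 Px))).
Qed.

Let c := d ^+ 3 * mu2.
Let c_gt0 : 0 < c. Proof. by rewrite mulr_gt0 // exprn_gt0. Qed.
Let c_real : c^* = c. Proof. by apply/CrealP; rewrite gtr0_real. Qed.

Let t_e1e1 : t (e1 \o e1) = mu.
Proof. by congr t; exact: funext. Qed.

(** By the isometry, pairing with [x] is the functional [t (Fs y)], which [Fs_tr] computes as
    [c * t (e1 \o y)]; the same functional is pairing with [c e1]. *)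
Lemma Fs_unit x : relcomm N M1 x -> Fs x = id ->
  c ^+ 2 * mu = 1 /\ x = (fun v => c *: e1 v).
Proof.
move=> Px Fx.
have [x' Px' ax] := oa_adj aP Px.
have aF : adjoint (Fs x) id by rewrite Fx.
have iso y : relcomm N M1 y -> t (Fs y) = t (x' \o y).
  by move=> Py; exact: (Fs_isometry Py Px ax aF).
have h1 : c * t (e1 \o x) = 1 by rewrite -Fs_tr // Fx (ntr_id tM2).
have h2 : t (x' \o e1) = c * mu by rewrite -iso // Fs_tr // t_e1e1.
have h3 : t (x' \o x) = 1 by rewrite -iso // Fx (ntr_id tM2).
have h4 : t (e1 \o x) = c * mu.
  have := tr_star aM2 tM2 (oa_comp aM2 M2e1 (P2 Px)) (adjoint_comp ae1 ax).
  rewrite h2 => /(congr1 (fun z => z^*)); rewrite conjCK => <-.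
  by rewrite rmorphM /= c_real; congr (_ * _); apply/CrealP; rewrite gtr0_real.
have h5 : c ^+ 2 * mu = 1 by rewrite -h1 h4 expr2 mulrA.
split=> //; apply: (tr_dist aM2 tM2 c (P2 Px) M2e1 ax ae1).2.
rewrite h3 h2 h4 t_e1e1 c_real.
have -> : 1 - c * (c * mu) - c * (c * mu) + c * c * mu = 1 - c ^+ 2 * mu by ring.
by rewrite h5 subrr.
Qed.

Let id_pre : exists2 x, relcomm N M1 x & Fs x = id.
Proof. exact: Fs_onto (oa_id aQ). Qed.

Let c_mu : c ^+ 2 * mu = 1.
Proof. by have [x Px /(Fs_unit Px)[]] := id_pre. Qed.

Let realz (z : R[i]) : 0 < z -> z^* = z.
Proof. by move=> z0; apply/CrealP; rewrite gtr0_real. Qed.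

(** This is Bessel's inequality: [d ^+ 3 * mu] is the coefficient of the projection of [Fs id] onto
    [e2]. Writing the squared norm 1 of [Fs id] as [c ^+ 2 * mu] makes the difference [mu2 - mu]
    factor out. *)
Let mu_le : mu <= mu2.
Proof.
have Pid := oa_id aP; have QF := Fs_range Pid.
have [F' QF' aF] := oa_adj aQ QF.
have [h _] := tr_dist aM2 tM2 (d ^+ 3 * mu) (Q2 QF) M2e2 aF ae2.
have k1 : t (F' \o Fs id) = 1.
  by rewrite (Fs_isometry Pid Pid (@adjoint_id _ _) aF) (ntr_id tM2).
have k2 : t (Fs id \o e2) = d ^+ 3 * (mu * mu2).
  rewrite (Fs_weak Pid Qe2); congr (_ * _).
  by rewrite -(trZ aM2 tM2 _ M2e2); congr t; apply/funext => v /=; rewrite e212.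
have k3 : t (e2 \o Fs id) = d ^+ 3 * (mu * mu2) by rewrite (trC M2e2 (Q2 QF)).
have k0 : (d ^+ 3 * (mu * mu2))^* = d ^+ 3 * (mu * mu2).
  by apply: realz; rewrite !mulr_gt0 // exprn_gt0.
have k4 : t (F' \o e2) = d ^+ 3 * (mu * mu2).
  have := tr_star aM2 tM2 (oa_comp aM2 M2e2 (Q2 QF)) (adjoint_comp ae2 aF).
  by rewrite k3 k0 => ->.
have k5 : t (e2 \o e2) = mu2 by congr t; exact: funext.
have k6 : (d ^+ 3 * mu)^* = d ^+ 3 * mu by apply: realz; rewrite mulr_gt0 // exprn_gt0.
move: h; rewrite k1 k3 k4 k5 k6.
have -> : 1 - d ^+ 3 * mu * (d ^+ 3 * (mu * mu2)) -
   d ^+ 3 * mu * (d ^+ 3 * (mu * mu2)) + d ^+ 3 * mu * (d ^+ 3 * mu) * mu2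
   = c ^+ 2 * mu - (d ^+ 3) ^+ 2 * mu * mu2 * mu by rewrite c_mu; ring.
have -> : c ^+ 2 * mu - (d ^+ 3) ^+ 2 * mu * mu2 * mu =
  (d ^+ 3) ^+ 2 * mu * mu2 * (mu2 - mu) by rewrite /c; ring.
by rewrite pmulr_rge0 ?subr_ge0 // !mulr_gt0 // !exprn_gt0.
Qed.

(** The squared trace norm of [e1 e2 e1 - mu e1] is [mu ^+ 2 * (mu - mu2)]. Its sign reverses
    [mu_le], and its vanishing gives the second Temperley-Lieb relation. *)
Let mu2_le : mu2 <= mu /\ (mu2 = mu -> forall v, e1 (e2 (e1 v)) = mu *: e1 v).
Proof.
have M2f : M2 (e1 \o (e2 \o e1)) by apply: (oa_comp aM2) => //; exact: oa_comp.
have af : adjoint (e1 \o (e2 \o e1)) (e1 \o (e2 \o e1)).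
  by move=> u v /=; rewrite ae1 ae2 ae1.
have mur : mu^* = mu by exact: realz.
have h := tr_dist aM2 tM2 mu M2f M2e1 af ae1.
have k1 : t (e1 \o (e2 \o e1)) = mu * mu2.
  have m21 := oa_comp aM2 M2e2 M2e1.
  rewrite (trC M2e1 m21).
  transitivity (t (e2 \o e1)); first by congr t; apply/funext => v /=; rewrite e1K.
  by rewrite (trC M2e2 M2e1) (trx2 M1e1).
have k2 : t ((e1 \o (e2 \o e1)) \o e1) = mu * mu2.
  by rewrite -k1; congr t; apply/funext => v /=; rewrite e1K.
have k3 : t (e1 \o (e1 \o (e2 \o e1))) = mu * mu2.
  by rewrite -k1; congr t; apply/funext => v /=; rewrite e1K.
have l1 := oa_linear aM2 M2e1.
have k4 : t ((e1 \o (e2 \o e1)) \o (e1 \o (e2 \o e1))) = mu * (mu * mu2).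
  rewrite -k1 -(trZ aM2 tM2 _ M2f); congr t; apply/funext => v /=.
  by rewrite e1K e212 (linZ l1).
rewrite k2 k3 k4 t_e1e1 mur in h.
have e : mu * (mu * mu2) - mu * (mu * mu2) - mu * (mu * mu2) + mu * mu * mu
   = mu ^+ 2 * (mu - mu2) by ring.
rewrite e in h; case: h => h1 h2; split.
  by move: h1; rewrite pmulr_rge0 ?subr_ge0 // exprn_gt0.
move=> m v; have := h2; rewrite m subrr mulr0 => /(_ erefl).
by move=> /(congr1 (@^~ v)).
Qed.

Lemma mu_eq : mu2 = mu.
Proof. by apply/eqP; rewrite eq_le mu_le mu2_le.1. Qed.

Let e121 v : e1 (e2 (e1 v)) = mu *: e1 v.
Proof. exact: mu2_le.2 mu_eq v. Qed.

Lemma mu_delta : mu * d ^+ 2 = 1.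
Proof.
have : (mu * d ^+ 2) ^+ 3 = 1 by rewrite -c_mu /c mu_eq; ring.
(* Nonnegativity selects the root 1 among the complex cube roots of unity. *)
move=> h; have p : 0 <= mu * d ^+ 2 by rewrite mulr_ge0 ?exprn_ge0 // ltW.
by apply/eqP; rewrite -(@eqrXn2 _ 3 _ 1) // h expr1n.
Qed.

(** Substituting 1 for [Fs (c e1)] in [Fs_weak] places [e1 e2 e1] in front of [z], and [e121]
    collapses it. *)
Lemma trace_e1_dual z : relcomm M M2 z -> t (e1 \o z) = mu * t z.
Proof.
move=> Qz; have [x Px Fx] := id_pre; have [_ xe] := Fs_unit Px Fx.
have M2z := Q2 Qz.
have : t z = d ^+ 3 * (c * (mu * t (e1 \o z))).
  transitivity (t (Fs x \o z)); first by rewrite Fx.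
  rewrite (Fs_weak Px Qz) xe; congr (_ * _).
  have m := oa_comp aM2 M2e1 M2z.
  rewrite -(trZ aM2 tM2 _ m) -(trZ aM2 tM2 _ (oa_scale aM2 _ m)).
  by congr t; apply/funext => v /=; rewrite e121.
move=> ->; rewrite /c mu_eq.
have -> : mu * (d ^+ 3 * (d ^+ 3 * mu * (mu * t (e1 \o z)))) =
  (mu * d ^+ 2) ^+ 3 * t (e1 \o z) by ring.
by rewrite mu_delta expr1n mul1r.
Qed.

(** With [n = t (x' \o x)], the square terms of the distance are [mu * n] and
    [d ^+ 2 * mu ^+ 2 * n], and each mixed term is [d * n / d ^+ 3]; they cancel because
    [mu * d ^+ 2 = 1]. *)
Lemma Fs_strong x v : relcomm N M1 x -> Fs x (e1 v) = d *: x (e2 (e1 v)).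
Proof.
move=> Px; have [x' Px' ax] := oa_adj aP Px; have QF := Fs_range Px.
have [F' QF' aF] := oa_adj aQ QF.
have M2x := P2 Px; have M2x' := P2 Px'; have M2F := Q2 QF; have M2F' := Q2 QF'.
have mS := oa_comp aM2 M2F M2e1.
have m21 := oa_comp aM2 M2e2 M2e1.
have mT := oa_comp aM2 M2x m21.
have m12 := oa_comp aM2 M2e1 M2e2.
have aS := adjoint_comp aF ae1.
have aT := adjoint_comp ax (adjoint_comp ae2 ae1).
have [_ h] := tr_dist aM2 tM2 d mS mT aS aT.
suff : Fs x \o e1 = (fun v => d *: (x \o (e2 \o e1)) v).
  by move=> /(congr1 (@^~ v)).
apply: h; pose n := t (x' \o x).
have dr : d^* = d by exact: realz.
have k1 : t ((e1 \o F') \o (Fs x \o e1)) = mu * n.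
  have m := oa_comp aM2 M2F' M2F.
  transitivity (t ((e1 \o (F' \o Fs x)) \o e1)); first by [].
  rewrite (trC (oa_comp aM2 M2e1 m) M2e1).
  transitivity (t (e1 \o (F' \o Fs x))).
    by congr t; apply/funext => w /=; rewrite e1K.
  rewrite trace_e1_dual; last exact: (oa_comp aQ).
  by rewrite (Fs_isometry Px Px ax aF).
have k2 : d ^+ 3 * t ((e1 \o F') \o (x \o (e2 \o e1))) = n.
  have m := oa_comp aM2 M2F' mT.
  transitivity (d ^+ 3 * t (e1 \o (F' \o (x \o (e2 \o e1))))); first by [].
  rewrite (trC M2e1 m).
  transitivity (d ^+ 3 * t (F' \o (x \o (e2 \o e1)))).
    by congr (_ * t _); apply/funext => w /=; rewrite e1K.
  rewrite (trC M2F' mT).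
  transitivity (t (Fs x \o F')); first by rewrite (Fs_weak Px QF').
  by rewrite (trC M2F M2F') (Fs_isometry Px Px ax aF).
have nr : n^* = n.
  apply/CrealP; apply: ger0_real; exact: (ntr_pos tM2 M2x M2x' ax).
have k3 : d ^+ 3 * t (((e1 \o e2) \o x') \o (Fs x \o e1)) = n.
  have m := oa_comp aM2 (oa_comp aM2 M2e1 M2F') mT.
  have := tr_star aM2 tM2 m (adjoint_comp (adjoint_sym aS) aT).
  move=> ->; rewrite -nr -k2 rmorphM /= rmorphXn /= dr //.
have k4 : t (((e1 \o e2) \o x') \o (x \o (e2 \o e1))) = mu ^+ 2 * n.
  have m := oa_comp aM2 M2x' M2x.
  transitivity (t ((e1 \o e2) \o ((x' \o x) \o (e2 \o e1)))); first by [].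
  rewrite (trC m12 (oa_comp aM2 m m21)).
  transitivity (t (fun v => mu *: ((x' \o x) \o e2) v)).
    congr t; apply/funext => w /=; rewrite e1K e212.
    by rewrite (linZ (oa_linear aM2 M2x)) (linZ (oa_linear aM2 M2x')).
  rewrite (trZ aM2 tM2 _ (oa_comp aM2 m M2e2)) trx2; last exact: (oa_comp aM1 (P1 Px') (P1 Px)).
  by rewrite mu_eq /n; ring.
have d3 : d ^+ 3 != 0 by rewrite expf_neq0 // gt_eqF.
rewrite k1 k4 dr; apply: (mulfI d3); rewrite mulr0.
move: k2 k3; set p := t _; set q := t _ => k2 k3.
have -> : d ^+ 3 * (mu * n - d * p - d * q + d * d * (mu ^+ 2 * n)) =
  d ^+ 3 * (mu * n + d * d * (mu ^+ 2 * n)) - d * (d ^+ 3 * p) - d * (d ^+ 3 * q) by ring.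
rewrite k2 k3.
have -> : d ^+ 3 * (mu * n + d * d * (mu ^+ 2 * n)) - d * n - d * n =
  d * n * ((mu * d ^+ 2) + (mu * d ^+ 2) ^+ 2 - 2) by ring.
by rewrite mu_delta expr1n -[1 + 1]mulr2n subrr mulr0.
Qed.
End Fourier.

(** * Positivity of the convolution in the tower *)

(** Nonnegativity in [R[i]] includes reality, so the real part and the imaginary part pass to the
    limit separately. *)
Lemma adherent_ge0 (R : realType) (H : hilbertSpace R) (A : set H) (T : H -> H) :
  bounded_op T -> (forall a, A a -> 0 <= ip H (T a) a) ->
  forall v, adherent A v -> 0 <= ip H (T v) v.
Proof.
move=> bT pA v av; have [C C0 hC] := bounded_opC bT.
have near e : 0 < e -> exists2 a, A a & rnorm (ip H (T v) v - ip H (T a) a) <= e.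
  move=> e0; pose B := C * (2 * hn v + 1) + 1.
  have B0 : 0 < B by rewrite ltr_wpDl // mulr_ge0 ?(ltW C0) // addr_ge0 // mulr_ge0 ?hn_ge0.
  have m0 : 0 < Num.min 1 (e / B) by rewrite lt_min ltr01 divr_gt0.
  have [a Aa] := av _ m0; rewrite lt_min => /andP[a1 aB]; exists a => //.
  have -> : ip H (T v) v - ip H (T a) a = ip H (T (v - a)) v + ip H (T a) (v - a).
    by rewrite (linB (bounded_lin bT)) ipBl ipBr addrA subrK.
  apply: (@le_trans _ _ (C * hn (v - a) * hn v + C * hn a * hn (v - a))).
    have h1 := cauchy_schwarz (T (v - a)) v; have h2 := cauchy_schwarz (T a) (v - a).
    have h3 := ler_wpM2r (hn_ge0 v) (hC (v - a)).
    have h4 := ler_wpM2r (hn_ge0 (v - a)) (hC a).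
    apply: (@le_trans _ _ (rnorm (ip H (T (v - a)) v) + rnorm (ip H (T a) (v - a)))).
      by rewrite -lecR realcD -!rnormE ler_normD.
    lra.
  have a2 : hn a <= hn v + 1.
    by have := ler_hn_dist v a 0; rewrite !subr0; lra.
  move: aB; rewrite ltr_pdivlMr // hn_distC /B => aB.
  have h0 := hn_ge0 (v - a).
  have := ler_wpM2l (mulr_ge0 (ltW C0) h0) a2; lra.
have pr e a : A a -> rnorm (ip H (T v) v - ip H (T a) a) <= e ->
    - e <= complex.Re (ip H (T v) v) /\ `|complex.Im (ip H (T v) v)| <= e.
  move=> /pA; case: (ip H (T v) v) => x y; case: (ip H (T a) a) => x' y'.
  rewrite lecE /= => /andP[/eqP-> x0]; rewrite /rnorm normc_def /= oppr0 addr0.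
  set s := Num.sqrt _ => h.
  have h1 : `|x - x'| <= s by rewrite -sqrtr_sqr ler_wsqrtr // lerDl sqr_ge0.
  have h2 : `|y| <= s by rewrite -sqrtr_sqr ler_wsqrtr // lerDr sqr_ge0.
  split; last exact: le_trans h2 h.
  by have := ler_norm (x' - x); rewrite distrC in h1; lra.
rewrite lecE /=; apply/andP; split.
  rewrite -normr_eq0 eq_le normr_ge0 andbT; apply: le_eps0 => e e0.
  by have [a Aa /(pr _ _ Aa)[]] := near e e0.
rewrite -oppr_le0; apply: le_eps0 => e e0.
by have [a Aa /(pr _ _ Aa)[h _]] := near e e0; lra.
Qed.

Section Positivity.
Context {R : realType} {H : hilbertSpace R}.
Variables (N M M1 M2 : set (H -> H)) (e1 e2 : H -> H) (t : (H -> H) -> R[i]).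
Variables (delta : R) (E : (H -> H) -> (H -> H)).
Hypothesis jt : jones_tower N M M1 M2 e1 e2 t delta.
Hypothesis abelian : forall x y, relcomm N M1 x -> relcomm N M1 y -> x \o y = y \o x.
Hypothesis hE : conditional_expectation (relcomm N M2) (relcomm M M2) t E.

Let Fs := string_fourier delta E e1 e2.
Let d : R[i] := real_complex R delta.

Hypothesis Fs_isometry : forall x y y' z', relcomm N M1 x -> relcomm N M1 y ->
  adjoint y y' -> adjoint (Fs y) z' -> t (z' \o Fs x) = t (y' \o x).
Hypothesis Fs_onto : forall z, relcomm M M2 z -> exists2 x, relcomm N M1 x & Fs x = z.

Let aN : opalg N. Proof. by have [] := jt_opalg jt. Qed.
Let aM : opalg M. Proof. by have [] := jt_opalg jt. Qed.
Let aM1 : opalg M1. Proof. by have [] := jt_opalg jt. Qed.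
Let aM2 : opalg M2. Proof. by have [] := jt_opalg jt. Qed.
Let sN : N `<=` M. Proof. by have [] := jt_sub jt. Qed.
Let sM : M `<=` M1. Proof. by have [] := jt_sub jt. Qed.
Let sM1 : M1 `<=` M2. Proof. by have [] := jt_sub jt. Qed.
Let sMM2 : M `<=` M2. Proof. by move=> T /sM/sM1. Qed.
Let tM2 := jt_trace jt.
Let aP : opalg (relcomm N M1). Proof. exact: relcomm_opalg. Qed.
Let aQ : opalg (relcomm M M2). Proof. exact: relcomm_opalg. Qed.
Let mu := t e1.
Let d_ge0 : 0 <= d. Proof. by rewrite ler0c ltW // (jt_delta jt). Qed.

Let M1e1 : M1 e1. Proof. by have [] := e1_props jt. Qed.
Let ae1 : adjoint e1 e1. Proof. by have [] := e1_props jt. Qed.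
Let M2e2 : M2 e2. Proof. by have [] := e2_props jt. Qed.
Let ae2 : adjoint e2 e2. Proof. by have [] := e2_props jt. Qed.
Let M2e1 : M2 e1 := sM1 M1e1.

Let trC S T : M2 S -> M2 T -> t (S \o T) = t (T \o S).
Proof. exact: (ntr_comm tM2). Qed.
Let md : mu * d ^+ 2 = 1.
Proof. exact: (mu_delta jt abelian hE Fs_isometry Fs_onto). Qed.
Let strong x v : relcomm N M1 x -> Fs x (e1 v) = d *: x (e2 (e1 v)).
Proof. exact: (Fs_strong jt abelian hE Fs_isometry Fs_onto). Qed.
Let range x : relcomm N M1 x -> relcomm M M2 (Fs x).
Proof. exact: (Fs_range jt hE). Qed.
Let e212 v : e2 (e1 (e2 v)) = mu *: e2 v.
Proof. exact: (e2_e1_e2 jt abelian). Qed.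
Let tre2 : t e2 = mu.
Proof. exact: (mu_eq jt abelian hE Fs_isometry Fs_onto). Qed.
Let trx2 x : M1 x -> t (x \o e2) = t x * mu.
Proof. by rewrite -tre2; exact: (trace_e2 jt abelian). Qed.
Let P1 x : relcomm N M1 x -> M1 x. Proof. by case. Qed.
Let P2 x : relcomm N M1 x -> M2 x. Proof. by move=> /P1/sM1. Qed.
Let Q2 x : relcomm M M2 x -> M2 x. Proof. by case. Qed.
Let comM x m v : relcomm M M2 x -> M m -> x (m v) = m (x v).
Proof. by move=> [cx _] Mm; exact: commutantP cx Mm. Qed.

Variables (K : hilbertSpace R) (rho : (H -> H) -> K -> K) (Om : K).
Hypotheses (iM2 : vn_isomorphism M2 rho) (gM1 : gns M1 t rho Om).
Hypothesis pe2 : orthogonal_projection (cyclic_subspace (rho @` M) Om) (rho e2).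
Hypothesis dM2 : rho @` M2 = commutant (commutant (rho @` M1 `|` [set rho e2])).
Let iM1 : vn_isomorphism M1 rho := gns_iso gM1.

Let e2m m : M m -> rho e2 (rho m Om) = rho m Om.
Proof. exact: (bc_fix aM aM1 sM gM1 pe2). Qed.
Let e21m m : M m -> rho (e2 \o (e1 \o m)) Om = mu *: rho m Om.
Proof.
move=> Mm; have M2m := sMM2 Mm; have m1 := oa_comp aM2 M2e1 M2m.
rewrite (rho_comp iM2 _ M2e2 m1) (rho_comp iM2 _ M2e1 M2m) -{1}(e2m Mm).
have m12 := oa_comp aM2 M2e1 M2e2.
rewrite -(rho_comp iM2 _ M2e1 M2e2) -(rho_comp iM2 _ M2e2 m12).
have -> : e2 \o (e1 \o e2) = (fun v => mu *: e2 v) by exact: funext.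
by rewrite (rho_scale aM2 iM2 mu M2e2) e2m.
Qed.

(** The span of [M e1 M], built term by term so that sesquilinear identities extend by induction. *)
Inductive MeM : (H -> H) -> Prop :=
| MeM0 : MeM (fun=> 0)
| MeM_lin c m n s : M m -> M n -> MeM s ->
    MeM (fun v => c *: m (e1 (n v)) + s v).

Let M1men m n : M m -> M n -> M1 (m \o (e1 \o n)).
Proof.
move=> Mm Mn; apply: (oa_comp aM1 (sM Mm)); exact: (oa_comp aM1 M1e1 (sM Mn)).
Qed.

Lemma MeM_M1 s : MeM s -> M1 s.
Proof.
elim=> [|c m n s' Mm Mn _ Ms]; first exact: oa_zero.
exact: (oa_lin aM1 c (M1men Mm Mn) Ms).
Qed.

Lemma MeM_left x s : M x -> MeM s -> MeM (x \o s).
Proof.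
move=> Mx; elim=> [|c m n s' Mm Mn _ IH].
  have -> : x \o (fun=> 0) = (fun=> 0) :> (H -> H).
    by apply/funext => v /=; rewrite (lin0 (oa_linear aM Mx)).
  exact: MeM0.
have := MeM_lin c (oa_comp aM Mx Mm) Mn IH; congr (MeM _); apply/funext => v /=.
by rewrite (linD (oa_linear aM Mx)) (linZ (oa_linear aM Mx)).
Qed.

Lemma MeM_right x s : M x -> MeM s -> MeM (s \o x).
Proof.
move=> Mx; elim=> [|c m n s' Mm Mn _ IH]; first exact: MeM0.
exact: (MeM_lin c Mm (oa_comp aM Mn Mx) IH).
Qed.

Lemma MeM_e1 : MeM e1.
Proof.
have := MeM_lin 1 (oa_id aM) (oa_id aM) MeM0; congr (MeM _); apply/funext => v.
by rewrite scale1r addr0.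
Qed.

(** * The pairing identity and its positivity *)

Section Pairing.
Variables (U V V' : H -> H).
Hypotheses (PU : relcomm N M1 U) (PV : relcomm N M1 V) (aV : adjoint V V').
Hypothesis Qsa : adjoint (Fs V') (Fs V').
Let PV' : relcomm N M1 V' := oa_mem_adj aP PV aV.
Let Z := Fs (U \o V).
Let PUV : relcomm N M1 (U \o V) := oa_comp aP PU PV.

(** This is the adjoint of [Fs_strong] at [V'], which is where self-adjointness of [Fs V']
    enters. *)
Let e1Q v : e1 (Fs V' v) = d *: e1 (e2 (V v)).
Proof.
apply: ip_ext => w; rewrite ae1 Qsa (strong _ PV') ipZr ipZl.
have -> : d^* = d by apply/CrealP; apply: ger0_real; rewrite ler0c ltW // (jt_delta jt).
by rewrite -aV -ae2 -ae1.
Qed.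

(** Both sides equal [d * mu] times the trace of [r' m U V n], with [r'] the adjoint of [m1 e1 n1].
    On the left, [Z] passes [m] and [Z e1 n Om] becomes [d mu U V n Om]. On the right, [Fs V']
    passes [n], then [Fs U e1 e2 = d mu U e2], and [trace_e2] removes [e2]. *)
Let pairing0 m n m1 n1 m1' n1' : M m -> M n -> M m1 -> M n1 ->
  adjoint m1 m1' -> adjoint n1 n1' ->
  ip K (rho Z (rho (m \o (e1 \o n)) Om)) (rho (m1 \o (e1 \o n1)) Om) =
  d * t ((n1' \o (e1 \o m1')) \o (Fs U \o (m \o (e1 \o n) \o Fs V'))).
Proof.
move=> Mm Mn Mm1 Mn1 am an.
have Mm' := oa_mem_adj aM Mm1 am; have Mn' := oa_mem_adj aM Mn1 an.
have QZ := range PUV; have QU := range PU; have QV := range PV'.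
have M1U := P1 PU; have M1V := P1 PV.
have M1UVn := oa_comp aM1 (oa_comp aM1 M1U M1V) (sM Mn).
have mUVn : M1 (m \o ((U \o V) \o n)) by exact: (oa_comp aM1 (sM Mm) M1UVn).
have men := M1men Mm Mn; have men1 := M1men Mm1 Mn1.
have men1' := M1men Mn' Mm'.
have am1 : adjoint (m1 \o (e1 \o n1)) (n1' \o (e1 \o m1')).
  by move=> u v /=; rewrite am ae1 an.
have lm := oa_linear aM Mm; have lU := oa_linear aM1 M1U.
have le1 := oa_linear aM1 M1e1.
have m21n := oa_comp aM2 M2e2 (oa_comp aM2 M2e1 (sMM2 Mn)).
have mUV := oa_comp aM1 (sM Mm) (oa_comp aM1 M1U M1V).
have -> : rho Z (rho (m \o (e1 \o n)) Om) = d *: (mu *: rho (m \o ((U \o V) \o n)) Om).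
  rewrite -(rho_comp iM2 _ (Q2 QZ) (sM1 men)).
  have -> : Z \o (m \o (e1 \o n)) =
      (fun v => d *: ((m \o (U \o V)) \o (e2 \o (e1 \o n))) v).
    by apply/funext => v; rewrite /Z /= (comM _ QZ Mm) (strong _ PUV) (linZ lm).
  have big := oa_comp aM2 (sM1 mUV) m21n.
  rewrite (rho_scale aM2 iM2 d big) (rho_comp iM2 _ (sM1 mUV) m21n) (e21m Mn).
  rewrite (linZ (rho_linear iM1 mUV)) -(rho_comp iM1 _ mUV (sM Mn)).
  by [].
rewrite !ipZl (gns_ip aM1 iM1 gM1 mUVn men1 am1); congr (_ * _).
have X1 := oa_comp aM1 men1' (oa_comp aM1 (sM Mm) M1U).
have M1Vn := oa_comp aM1 M1V (sM Mn).
have -> : t ((n1' \o (e1 \o m1')) \o (Fs U \o (m \o (e1 \o n) \o Fs V'))) =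
    t (fun v => (d ^+ 2 * mu) *: ((n1' \o (e1 \o m1') \o (m \o U)) \o (e2 \o (V \o n))) v).
  congr t; apply/funext => v /=.
  rewrite -(comM v QV Mn) e1Q.
  rewrite (linZ lm) (linZ (oa_linear aM2 (Q2 QU))) (comM _ QU Mm) (strong _ PU) e212.
  rewrite (linZ lU) !(linZ lm) (linZ (oa_linear aM Mm')).
  rewrite (linZ (oa_linear aM Mm')) (linZ (oa_linear aM Mm')).
  rewrite !(linZ le1) !(linZ (oa_linear aM Mn')) !scalerA; congr (_ *: _); ring.
have m2Vn := oa_comp aM2 M2e2 (sM1 M1Vn).
rewrite (trZ aM2 tM2 _ (oa_comp aM2 (sM1 X1) m2Vn)).
have -> : d ^+ 2 * mu = 1 by rewrite mulrC md.
rewrite mul1r (trC (sM1 X1) m2Vn).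
transitivity (t (e2 \o ((V \o n) \o (n1' \o (e1 \o m1') \o (m \o U))))); last by [].
have X2 := oa_comp aM1 M1Vn X1.
rewrite (trC M2e2 (sM1 X2)) (trx2 X2) mulrC; congr (_ * _).
by rewrite (trC (sM1 M1Vn) (sM1 X1)).
Qed.

Let Bl s r := ip K (rho Z (rho s Om)) (rho r Om).
Let Br s r' := d * t (r' \o (Fs U \o (s \o Fs V'))).

Let mBr s r' : M2 s -> M2 r' -> M2 (r' \o (Fs U \o (s \o Fs V'))).
Proof.
move=> Ms Mr; apply: (oa_comp aM2 Mr (oa_comp aM2 (Q2 (range PU)) _)).
exact: (oa_comp aM2 Ms (Q2 (range PV'))).
Qed.

Lemma pairing s r r' : MeM s -> MeM r -> adjoint r r' -> Bl s r = Br s r'.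
Proof.
move=> hs hr; elim: hr r' => {r} [|c m1 n1 r Mm1 Mn1 hr IH] r' ar.
  have -> : r' = (fun=> 0).
    by apply: adjoint_uniq ar _ => u v; rewrite ip0l ip0r.
  rewrite /Bl /Br (rho_zero aM1 iM1) ip0r.
  have -> : (fun=> 0) \o (Fs U \o (s \o Fs V')) = (fun=> 0) :> (H -> H) by [].
  by rewrite (tr0 aM2 tM2) mulr0.
have [m1' Mm1' am] := oa_adj aM Mm1; have [n1' Mn1' an] := oa_adj aM Mn1.
have [q M1q aq] := oa_adj aM1 (MeM_M1 hr).
have men1 := M1men Mm1 Mn1.
have am1 : adjoint (m1 \o (e1 \o n1)) (n1' \o (e1 \o m1')).
  by move=> u v /=; rewrite am ae1 an.
have men1' := M1men Mn1' Mm1'.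
have -> : r' = (fun v => c^* *: (n1' \o (e1 \o m1')) v + q v).
  exact: adjoint_uniq ar (adjoint_lin c am1 aq).
have M2s := sM1 (MeM_M1 hs).
have k : Br s (fun v => c^* *: (n1' \o (e1 \o m1')) v + q v) =
    c^* * Br s (n1' \o (e1 \o m1')) + Br s q.
  rewrite /Br mulrCA -mulrDr; congr (_ * _).
  exact: (ntr_linear tM2 c^* (mBr M2s (sM1 men1')) (mBr M2s (sM1 M1q))).
rewrite k -(IH _ aq) /Bl (vni_linear iM1 c men1 (MeM_M1 hr)) ipDr ipZr.
congr (_ * _ + _).
have QZ := range PUV.
have lZ := rho_linear iM2 (Q2 QZ).
elim: hs {M2s IH k} => [|c' m n s' Mm Mn hs' IH].
  rewrite (rho_zero aM1 iM1) (lin0 lZ) ip0l /Br.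
  have -> : (n1' \o (e1 \o m1')) \o (Fs U \o ((fun=> 0) \o Fs V')) = (fun=> 0).
    apply/funext => v /=; rewrite (lin0 (oa_linear aM2 (Q2 (range PU)))).
    rewrite (lin0 (oa_linear aM Mm1')) (lin0 (oa_linear aM1 M1e1)).
    by rewrite (lin0 (oa_linear aM Mn1')).
  by rewrite (tr0 aM2 tM2) mulr0.
have men := M1men Mm Mn.
rewrite (vni_linear iM1 c' men (MeM_M1 hs')) lZ ipDl ipZl IH.
rewrite (pairing0 Mm Mn Mm1 Mn1 am an) /Br mulrCA -mulrDr; congr (_ * _).
rewrite -(ntr_linear tM2 c' (mBr (sM1 men) (sM1 men1')) (mBr (sM1 (MeM_M1 hs')) (sM1 men1'))).
congr t; apply/funext => v /=.
have lU := oa_linear aM2 (Q2 (range PU)).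
by rewrite lU (oa_linear aM Mm1') (oa_linear aM1 M1e1) (oa_linear aM Mn1').
Qed.

Variables (A A' B B' : H -> H).
Hypotheses (QA : relcomm M M2 A) (QB : relcomm M M2 B).
Hypotheses (aA : adjoint A A') (aB : adjoint B B').
Hypotheses (UA : Fs U = A' \o A) (VB : Fs V' = B' \o B).

Lemma pairing_ge0 s : MeM s -> 0 <= ip K (rho Z (rho s Om)) (rho s Om).
Proof.
move=> hs; have M1s := MeM_M1 hs; have M2s := sM1 M1s.
have [s' Ms' as'] := oa_adj aM1 M1s.
rewrite (pairing hs hs as' : ip K (rho Z (rho s Om)) (rho s Om) = _) /Br UA VB.
have MA' := Q2 (oa_mem_adj aQ QA aA); have MB' := Q2 (oa_mem_adj aQ QB aB).
have MA := Q2 QA; have MB := Q2 QB; have M2s' := sM1 Ms'.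
have m1 := oa_comp aM2 MA (oa_comp aM2 M2s MB').
apply: mulr_ge0; first exact: d_ge0.
(* Cyclicity carries the last [B] to the front, which leaves the squared trace norm of [A s B']. *)
have -> : t (s' \o ((A' \o A) \o (s \o (B' \o B)))) =
    t ((B \o (s' \o A')) \o (A \o (s \o B'))).
  have n1 := oa_comp aM2 M2s' (oa_comp aM2 MA' m1).
  transitivity (t ((s' \o (A' \o (A \o (s \o B')))) \o B)); first by [].
  by rewrite (trC n1 MB).
apply: (ntr_pos tM2 m1); first exact: (oa_comp aM2 MB (oa_comp aM2 M2s' MA')).
move=> u v /=; rewrite aA as'; exact: (adjoint_sym aB).
Qed.
End Pairing.

(** * Density of the vectors [s Om] in L^2(M1) *)

Let V := adherent [set rho s Om | s in MeM].

Let V_subspace : subspace V.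
Proof.
apply: adherent_subspace; split.
  by exists (fun=> 0); [exact: MeM0|rewrite (rho_zero aM1 iM1)].
move=> c _ _ [r hr <-] [s hs <-].
have : MeM (fun v => c *: r v + s v).
  elim: hr => [|c' m n r' Mm Mn _ IH].
    by have -> : (fun v : H => c *: (0 : H) + s v) = s;
      [apply/funext => v; rewrite scaler0 add0r|].
  have := MeM_lin (c * c') Mm Mn IH; congr (MeM _); apply/funext => v /=.
  by rewrite scalerDr scalerA addrA.
exists (fun v => c *: r v + s v) => //.
by rewrite (vni_linear iM1 c (MeM_M1 hr) (MeM_M1 hs)).
Qed.

Let V_closed v : adherent V v -> V v.
Proof. exact: adherent_closed. Qed.

Let V_in s : MeM s -> V (rho s Om).
Proof. by move=> hs e e0; exists (rho s Om); [exists s|rewrite subrr hn0]. Qed.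

Let V_left m v : M m -> V v -> V (rho m v).
Proof.
move=> Mm; apply: (adherent_map (rho_bounded iM1 (sM Mm))) => _ [s hs <-].
by rewrite -(rho_comp iM1 _ (sM Mm) (MeM_M1 hs)); apply: V_in; exact: MeM_left.
Qed.

Let X := rho @` M1 `|` [set rho e2].

(** Commuting with [e2], [T] sends [Om] into the closure of [M Om]; commuting with [s], it sends
    [s Om] into the closure of [s M Om], and the span is stable under right multiplication by
    [M]. *)
Let V_commutant T v : commutant X T -> V v -> V (T v).
Proof.
move=> cT; apply: (adherent_map cT.1) => _ [s hs <-].
have Ms := MeM_M1 hs.
have Xs : X (rho s) by left; exists s.
have Xe : X (rho e2) by right.
have TO : rho e2 (T Om) = T Om.
  by rewrite -(commutantP Om cT Xe) (bc_Om aM aM1 sM iM2 gM1 pe2).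
rewrite (commutantP Om cT Xs) -TO.
have in_M : adherent [set rho m Om | m in M] (rho e2 (T Om)).
  exact: (proj_in (bc_proj pe2) _).
apply: (adherent_map (rho_bounded iM1 Ms)) in_M => _ [m Mm <-].
rewrite -(rho_comp iM1 _ Ms (sM Mm)); apply: V_in; exact: MeM_right.
Qed.

Let X_adj S : X S -> exists2 S', X S' & adjoint S S'.
Proof.
move=> [[T MT <-]|->]; last first.
  by exists (rho e2); [right|exact: (vni_star iM2 M2e2 M2e2 ae2)].
have [T' MT' aT] := oa_adj aM1 MT; exists (rho T'); first by left; exists T'.
exact: (vni_star iM1 MT MT' aT).
Qed.

(** The GNS formula covers [M1] only. For [x = Fs c'], [Fs_strong] rewrites [x e1 Om] as
    [d mu c' Om], which brings the inner product back into its range. *)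
Let tr_Fs x : relcomm M M2 x -> t x = d ^+ 2 * ip K (rho x (rho e1 Om)) (rho e1 Om).
Proof.
move=> /Fs_onto [c' Pc <-]; have Qx := range Pc; have M1c := P1 Pc.
have Me1c := oa_comp aM1 M1e1 M1c.
have k1 : t (Fs c') = d ^+ 3 * (t (e1 \o c') * mu).
  have -> : t (Fs c') = d ^+ 3 * t (c' \o e2 \o e1).
    exact: (Fs_weak jt hE Pc (oa_id aQ)).
  rewrite (trC (oa_comp aM2 (sM1 M1c) M2e2) M2e1); congr (_ * _).
  exact: (trx2 Me1c).
have m21 := oa_comp aM2 M2e2 M2e1.
rewrite -(rho_comp iM2 _ (Q2 Qx) M2e1).
have -> : Fs c' \o e1 = (fun v => d *: (c' \o (e2 \o e1)) v).
  by apply/funext => v /=; rewrite (strong _ Pc).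
rewrite (rho_scale aM2 iM2 d (oa_comp aM2 (sM1 M1c) m21)).
rewrite (rho_comp iM2 _ (sM1 M1c) m21) (e21m (oa_id aM)) (vni_id iM1).
rewrite (linZ (rho_linear iM1 M1c)) !ipZl (gns_ip aM1 iM1 gM1 M1c M1e1 ae1) k1.
by ring.
Qed.

Lemma MeM_dense v : V v.
Proof.
have [P pP] := projection_exists V_subspace V_closed.
have cX : commutant (commutant X) P.
  split; first exact: (proj_bounded V_subspace pP).
  move=> T cT; have [T' aT bT'] := adjoint_exists cT.1.
  have cT' : commutant X T' by exact: (commutant_adj X_adj cT aT).
  apply: (proj_commute V_subspace pP (bounded_lin cT.1) aT) => w; exact: V_commutant.
have [f M2f rf] : (rho @` M2) P by rewrite dM2.
have Qf : relcomm M M2 f.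
  split=> //; split; first exact: (oa_bounded aM2 M2f).
  move=> m Mm; have M1m := sM Mm; have M2m := sM1 M1m.
  have [m' Mm' am] := oa_adj aM Mm.
  apply: (vni_inj iM2 (oa_comp aM2 M2f M2m) (oa_comp aM2 M2m M2f)).
  rewrite (vni_mul iM2 M2f M2m) (vni_mul iM2 M2m M2f) rf.
  apply: (proj_commute V_subspace pP (rho_linear iM1 M1m)
    (vni_star iM1 M1m (sM Mm') am)) => w; exact: V_left.
(* [g] is the projection onto the complement of [V]; it kills [e1 Om], so [tr_Fs] makes its trace
   vanish. *)
pose g := fun w => id w - f w.
have Qg : relcomm M M2 g by exact: (oa_sub aQ (oa_id aQ) Qf).
have rg k : rho g k = k - P k.
  by rewrite /g (rho_sub iM2 (oa_id aM2) M2f) (vni_id iM2) rf.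
have tg : t g = 0.
  rewrite (tr_Fs Qg) rg (proj_fix V_subspace pP (V_in MeM_e1)) subrr ip0l.
  by rewrite mulr0.
have ag : adjoint g g.
  have [f' M2f' af] := oa_adj aM2 M2f.
  have ff : f' = f.
    apply: (vni_inj iM2 M2f' M2f); rewrite rf.
    apply: adjoint_uniq (proj_adj pP); rewrite -rf.
    exact: (vni_star iM2 M2f M2f' af).
  by rewrite ff in af; move=> u w; rewrite /g ipBl ipBr af.
have gg : g \o g = g.
  have M2g := Q2 Qg; apply: (vni_inj iM2 (oa_comp aM2 M2g M2g) M2g).
  rewrite (vni_mul iM2 M2g M2g); apply/funext => k /=; rewrite !rg.
  rewrite (linB (proj_linear V_subspace pP)) (proj_fix V_subspace pP (proj_in pP k)).
  by rewrite subrr subr0.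
have g0 : g = (fun=> 0).
  by apply: (ntr_faithful tM2 (Q2 Qg) (Q2 Qg) ag); rewrite gg.
have := rg v; rewrite g0 (rho_zero aM2 iM2) => /esym/eqP.
by rewrite subr_eq0 => /eqP ->; exact: (proj_in pP v).
Qed.

Theorem schur_trace_ge0 U W W' A A' B B' w w' :
  relcomm N M1 U -> relcomm N M1 W -> adjoint W W' ->
  relcomm M M2 A -> relcomm M M2 B -> adjoint A A' -> adjoint B B' ->
  Fs U = A' \o A -> Fs W' = B' \o B ->
  relcomm M M2 w -> adjoint w w' ->
  0 <= t (w' \o (Fs (U \o W) \o w)).
Proof.
move=> PU PW aW QA QB aA aB UA WB Qw aw.
have Qsa : adjoint (Fs W') (Fs W').
  by rewrite WB; move=> u v /=; rewrite (adjoint_sym aB) aB.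
have QZ := range (oa_comp aP PU PW).
have M2Z := Q2 QZ; have M2w := Q2 Qw; have Qw' := oa_mem_adj aQ Qw aw.
have M2w' := Q2 Qw'.
rewrite (tr_Fs (oa_comp aQ Qw' (oa_comp aQ QZ Qw))).
apply: mulr_ge0; first by rewrite exprn_ge0.
rewrite (rho_comp iM2 _ M2w' (oa_comp aM2 M2Z M2w)) (rho_comp iM2 _ M2Z M2w).
rewrite (vni_star iM2 M2w' M2w (adjoint_sym aw)).
apply: (adherent_ge0 (rho_bounded iM2 M2Z) _ (MeM_dense _)) => _ [s hs <-].
exact: (pairing_ge0 PU PW aW Qsa QA QB aA aB UA WB hs).
Qed.
End Positivity.

(** * Positive elements of finite-dimensional algebras *)

Section FdCstar.
Context {R : realType} {B : fdCstarAlg R}.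
Implicit Types (x y z w : B) (c : R[i]).

Lemma star0 : star (0 : B) = 0.
Proof.
have := star_antilinear (-1) (0 : B) 0; rewrite scaler0 addr0 rmorphN rmorph1.
by rewrite scaleN1r addNr.
Qed.
Lemma starZ c x : star (c *: x) = c^* *: star x.
Proof. by rewrite -[c *: x]addr0 star_antilinear star0 addr0. Qed.
Lemma starD x y : star (x + y) = star x + star y.
Proof. by rewrite -[x]scale1r star_antilinear rmorph1 !scale1r. Qed.
Lemma star1 : star (1 : B) = 1.
Proof. by rewrite -[LHS]mulr1 -{2}(starK (1 : B)) -starM mulr1 starK. Qed.
Lemma cpositive_star x : cpositive x -> star x = x.
Proof. by move=> [a ->]; rewrite starM starK. Qed.

(** Polarization against the unit: the elements [q c], at the four fourth roots of unity [c],
    combine to [x]. *)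
Lemma cpositive_span (P : B -> Prop) : (forall x, cpositive x -> P x) ->
  (forall c x y, P x -> P y -> P (c *: x + y)) -> forall x, P x.
Proof.
move=> Ppos Plin x.
have P0 : P 0 by apply: Ppos; exists 0; rewrite mulr0.
pose q c := star (1 + c *: x) * (1 + c *: x).
have Pq c : P (q c) by apply: Ppos; exists (1 + c *: x).
(* The four coefficients are tracked formally; these elements of [B] need not be independent. *)
pose L a b c d := a *: (1 : B) + b *: x + c *: star x + d *: (star x * x).
have LD a b c d a' b' c' d' :
    L a b c d + L a' b' c' d' = L (a + a') (b + b') (c + c') (d + d').
  by rewrite /L !scalerDl addrACA; congr (_ + _); rewrite addrACA;
    congr (_ + _); rewrite addrACA.
have qL a c : a *: q c = L a (a * c) (a * c^*) (a * (c^* * c)).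
  rewrite /q starD starZ star1 mulrDl mul1r mulrDr mulr1.
  by rewrite -scalerAl -scalerAr scalerA addrA /L !scalerDr !scalerA.
have : P ((4^-1 : R[i]) *: q 1 + ((- 4^-1) *: q (- 1) +
    ((- 'i / 4) *: q 'i + (('i / 4) *: q (- 'i) + 0)))).
  by do 4!apply: (Plin _ _ _ (Pq _)).
congr P; rewrite addr0 !qL !LD !rmorphN !rmorph1 /= conjCi !opprK.
have i2 : 'i * 'i = -1 :> R[i] by rewrite -expr2 sqrCi.
rewrite /L -[RHS]add0r -[RHS]addr0 -[RHS]addr0.
congr (_ + _ + _ + _).
- by rewrite (_ : _ + _ = 0) ?scale0r //; field.
- rewrite -[RHS]scale1r; congr (_ *: _).
  have -> : 4^-1 * 1 + (- 4^-1 * -1 + (- 'i / 4 * 'i + 'i / 4 * - 'i)) =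
    (2 - 2 * ('i * 'i)) / 4 :> R[i] by field.
  by rewrite i2; field.
- rewrite -[RHS](scale0r (star x)); congr (_ *: _).
  have -> : 4^-1 * 1 + (- 4^-1 * -1 + (- 'i / 4 * - 'i + 'i / 4 * 'i)) =
    (2 + 2 * ('i * 'i)) / 4 :> R[i] by field.
  by rewrite i2; field.
- by rewrite -[RHS](scale0r (star x * x)); congr (_ *: _); field.
Qed.

Lemma star_horner z (p : {poly R[i]}) :
  star (horner_alg z p) = horner_alg (star z) (map_poly Num.conj p).
Proof.
elim/poly_ind: p => [|p c IH]; first by rewrite !rmorph0 star0.
rewrite !rmorphD !rmorphM /= map_polyX map_polyC !horner_algX !horner_algC.
rewrite starD starM IH starZ star1; congr (_ + _).
have := rmorphM (horner_alg (star z)) 'X (map_poly Num.conj p).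
by rewrite mulrC rmorphM /= horner_algX => ->.
Qed.

Lemma annihilator_exists z : exists2 p : {poly R[i]}, p != 0 & horner_alg z p = 0.
Proof.
pose n := \dim {: B}.
pose X := [tuple z ^+ i | i < n.+1].
have nf : ~~ free X.
  apply/negP => /eqP h; have := dimvS (subvf <<X>>%VS).
  by rewrite h size_tuple ltnn.
have [k [ks [i ki]]] : exists k : 'I_n.+1 -> R[i],
    \sum_(i < n.+1) k i *: X`_i = 0 /\ exists i, k i != 0.
  apply: contrapT => h; move/negP: nf; apply; apply/freeP => k ks i.
  by apply: contrapT => /eqP ki; apply: h; exists k; split=> //; exists i.
exists (\poly_(j < n.+1) k (inord j)).
  apply: contra_neq ki => /(congr1 (fun p : {poly R[i]} => p`_i)).
  by rewrite coef_poly coef0 ltn_ord inord_val.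
rewrite poly_def rmorph_sum /= -[RHS]ks; apply: eq_bigr => j _.
by rewrite -(tnth_nth 0) tnth_mktuple linearZ /= rmorphXn /= horner_algX inord_val mulr_algl.
Qed.

Lemma interpolation (rs : seq R[i]) (g : R[i] -> R[i]) :
  exists p : {poly R[i]}, forall r, r \in rs -> p.[r] = g r.
Proof.
elim: rs => [|a rs [p hp]]; first by exists 0.
have [ain|anin] := boolP (a \in rs).
  by exists p => r; rewrite inE => /orP[/eqP->|]; exact: hp.
pose m := \prod_(r <- rs) ('X - r%:P).
have ma : m.[a] != 0 by have := root_prod_XsubC rs a; rewrite /root -/m (negPf anin) => ->.
exists (p + ((g a - p.[a]) / m.[a]) *: m) => r.
rewrite inE hornerD hornerZ => /orP[/eqP->|rin]; first by rewrite divfK // addrC subrK.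
have /eqP -> : m.[r] == 0 by have := root_prod_XsubC rs r; rewrite /root -/m rin.
by rewrite mulr0 addr0 hp.
Qed.

Lemma uniq_notin_rem (T : eqType) (s : seq T) :
  (forall r, r \in s -> r \notin rem r s) -> uniq s.
Proof.
elim: s => //= a s IH h.
have an : a \notin s by have := h a (mem_head _ _); rewrite eqxx.
rewrite an IH // => r rs; have := h r; rewrite inE rs orbT => /(_ isT).
have [ar|ar] := eqVneq a r; first by rewrite ar rs in an.
by rewrite inE negb_or => /andP[].
Qed.

Variable tau : {scalar B}.
Hypothesis ft : faithful_trace tau.

(** Roots of the minimal polynomial are eigenvalues of left multiplication by [z]: nonnegative by
    the hypothesis at an eigenvector, simple because [z] is self-adjoint. A polynomial interpolating
    the square root at these roots then gives a square root of [z]. *)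
Lemma cpositive_trace z : star z = z -> (forall w, 0 <= tau (star w * (z * w))) ->
  cpositive z.
Proof.
case: ft => _ tpos tfaith sz hz.
pose ann n := `[< exists p : {poly R[i]}, [/\ p != 0, horner_alg z p = 0 & size p = n] >].
have [n /asboolP[p [p0 zp sp]] nmin] : exists2 n, ann n & forall m, ann m -> (n <= m)%N.
  have ex : exists n, ann n.
    by have [p p0 zp] := annihilator_exists z; exists (size p); apply/asboolP; exists p.
  by case: (ex_minnP ex) => n *; exists n.
have minimal (q : {poly R[i]}) : q != 0 -> (size q < size p)%N -> horner_alg z q != 0.
  move=> q0 sq; apply/eqP => zq; have : ann (size q) by apply/asboolP; exists q.
  by move=> /nmin; rewrite -sp leqNgt sq.
have [rs prs] := closed_field_poly_normal p.
have lc0 : lead_coef p != 0 by rewrite lead_coef_eq0.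
have zX r : horner_alg z ('X - r%:P) = z - r%:A.
  by rewrite rmorphB /= horner_algX horner_algC.
have fact r : r \in rs -> exists q, [/\ p = q * ('X - r%:P), horner_alg z q != 0 &
    root q r = (r \in rem r rs)].
  move=> rin; pose q := lead_coef p *: \prod_(a <- rem r rs) ('X - a%:P).
  have pq : p = q * ('X - r%:P).
    by rewrite {1}prs (perm_big _ (perm_to_rem rin)) /= big_cons mulrC scalerAl.
  have q0 : q != 0 by apply: contra_neq p0; rewrite pq => ->; rewrite mul0r.
  exists q; split=> //; last by rewrite /q rootZ // root_prod_XsubC.
  by apply: minimal => //; rewrite pq size_Mmonic ?monicXsubC // size_XsubC addn2.
have eig r : r \in rs -> exists w, [/\ z * w = r *: w, w != 0 & 0 <= r].
  move=> rin; have [q [pq zq _]] := fact r rin.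
  have e : z * horner_alg z q = r *: horner_alg z q.
    have := zp; rewrite pq mulrC rmorphM /= zX mulrBl mulr_algl => /eqP.
    by rewrite subr_eq0 => /eqP.
  exists (horner_alg z q); split=> //.
  have := hz (horner_alg z q); rewrite e -scalerAr linearZ /= => h.
  have t0 : tau (star (horner_alg z q) * horner_alg z q) != 0.
    by apply: contra_neq zq; exact: tfaith.
  have tp : 0 < tau (star (horner_alg z q) * horner_alg z q) by rewrite lt_def t0 tpos.
  by move: h; rewrite pmulr_lge0.
have urs : uniq rs.
  apply: uniq_notin_rem => r rin; have [_ [_ _ r0]] := eig r rin.
  (* At a double root, [q(z) = q'(z) (z - r)] while [(z - r) q(z) = 0]; self-adjointness of [z - r]
     then gives [star (q(z)) * q(z) = 0], against minimality. *)
  have [q [pq zq <-]] := fact r rin; apply/negP => /factor_theorem [q' qq'].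
  move/eqP: zq; apply; apply: tfaith.
  have sr : star (z - r%:A) = z - r%:A.
    rewrite -scaleN1r starD !starZ star1 sz rmorphN rmorph1.
    by have -> : r^* = r by apply/CrealP; rewrite ger0_real.
  have k : (z - r%:A) * horner_alg z q = 0.
    by have := zp; rewrite pq mulrC rmorphM /= zX.
  rewrite {1}qq' mulrC rmorphM /= zX starM sr -mulrA k mulr0.
  by rewrite linear0.
have [S hS] := interpolation rs sqrtC.
have vanish (q : {poly R[i]}) : (forall r, r \in rs -> q.[r] = 0) -> horner_alg z q = 0.
  move=> hq; have : \prod_(a <- rs) ('X - a%:P) %| q.
    apply: uniq_roots_dvdp; last by rewrite uniq_rootsE.
    by apply/allP => r /hq /eqP.
  have -> : (\prod_(a <- rs) ('X - a%:P) %| q) = (p %| q) by rewrite prs dvdpZl.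
  by move=> /dvdpP [q' ->]; rewrite rmorphM /= zp mulr0.
have sq : horner_alg z (S ^+ 2 - 'X) = 0.
  apply: vanish => r rin; rewrite hornerD hornerN hornerX horner_exp hS //.
  by rewrite sqrtCK subrr.
(* [S] may have nonreal coefficients, but it agrees with its conjugate at the real roots, so [S(z)]
   is self-adjoint. *)
have sS : horner_alg z (map_poly Num.conj S - S) = 0.
  apply: vanish => r rin; have [_ [_ _ r0]] := eig r rin.
  have rc : r^* = r by apply/CrealP; rewrite ger0_real.
  rewrite hornerD hornerN -{1}rc horner_map /= hS //.
  have -> : (sqrtC r)^* = sqrtC r by apply/CrealP; rewrite ger0_real // sqrtC_ge0.
  by rewrite subrr.
exists (horner_alg z S); rewrite star_horner sz.
move: sS; rewrite rmorphB /= => /eqP; rewrite subr_eq0 => /eqP ->.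
by move: sq; rewrite rmorphB rmorphXn /= horner_algX expr2 => /eqP; rewrite subr_eq0 => /eqP.
Qed.
End FdCstar.

(** * Fusion bialgebras *)

Section FusionBialgebra.
Context {R : realType} {A B : fdCstarAlg R}.
Variables (F : {linear A -> B}) (Finv : B -> A) (d : {scalar A}) (tau : {scalar B}).
Hypothesis fb : fusion_bialgebra F Finv d tau.

Let FK : cancel F Finv := fb_FK fb.
Let FinvK : cancel Finv F := fb_FinvK fb.

Lemma FinvP c x y : Finv (c *: x + y) = c *: Finv x + Finv y.
Proof. by apply: (can_inj FK); rewrite linearP /= !FinvK. Qed.

Lemma convA_Pl c x x' y :
  Defs.convA F Finv (c *: x + x') y =
  c *: Defs.convA F Finv x y + Defs.convA F Finv x' y.
Proof. by rewrite /Defs.convA linearP /= mulrDl -scalerAl FinvP. Qed.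
Lemma convA_Pr c x y y' :
  Defs.convA F Finv x (c *: y + y') =
  c *: Defs.convA F Finv x y + Defs.convA F Finv x y'.
Proof. by rewrite /Defs.convA linearP /= mulrDr -scalerAr FinvP. Qed.

(* Convolution preserves positive, hence self-adjoint, elements, which span. *)
Lemma star_convA x y :
  star (Defs.convA F Finv x y) = Defs.convA F Finv (star x) (star y).
Proof.
move: x; apply: cpositive_span => [x px|c x x' hx hx']; last first.
  by rewrite convA_Pl !star_antilinear convA_Pl hx hx'.
move: y; apply: cpositive_span => [y py|c y y' hy hy']; last first.
  by rewrite convA_Pr !star_antilinear convA_Pr hy hy'.
by rewrite !cpositive_star //; exact: fb_schur fb _ _ px py.
Qed.

(** The involution of [A] carried over to [B]; being multiplicative and star-preserving, it keeps
    elements of the form [star s * s] in that form. *)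
Definition rot (q : B) : B := F (star (Finv q)).

Lemma rotM p q : rot (p * q) = rot p * rot q.
Proof.
rewrite /rot.
have -> : Finv (p * q) = Defs.convA F Finv (Finv p) (Finv q).
  by rewrite /Defs.convA !FinvK.
by rewrite star_convA /Defs.convA FinvK.
Qed.
Lemma rot_star q : rot (star q) = star (rot q).
Proof.
have := fb_J_star fb (Finv q); rewrite /fbJ FinvK => /(congr1 F).
by rewrite FinvK /rot => <-.
Qed.

(** Multiplicativity of [fbJ] makes the transform of the product self-adjoint, so the outer star of
    [convB] disappears. *)
Lemma convB_self_adjoint x y : star x = x -> star y = y ->
  convB F Finv x y = F (Finv y * Finv x) /\
  star (F (Finv y * Finv x)) = F (Finv y * Finv x).
Proof.
move=> sx sy.
have e : star (F (Finv y * Finv x)) = F (Finv y * Finv x).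
  have := fb_J_mul fb (Finv y) (Finv x); rewrite /fbJ !FinvK sx sy.
  by move=> /(congr1 F); rewrite FinvK.
by rewrite /convB sx sy e.
Qed.
End FusionBialgebra.

Theorem proposition3p3 (R : realType) (A B : fdCstarAlg R)
    (F : {linear A -> B}) (Finv : B -> A) (d : {scalar A}) (tau : {scalar B}) :
  fusion_bialgebra F Finv d tau ->
  subfactorizable F d tau ->
  forall x y : B,
    cpositive x -> cpositive y -> cpositive (convB F Finv x y).
Proof.
move=> fb [H [N [M [M1 [M2 [e1 [e2 [t [delta [E]]]]]]]]]] /= [jt hE abel].
move=> [l1 [l2 [phi [psi [[l10 l20] iphi ipsi Fpsi [tphi tpsi]]]]]] x y px py.
have sx := cpositive_star px; have sy := cpositive_star py.
have [-> sz] := convB_self_adjoint fb sx sy.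
set z := F _ in sz *.
have FK := fb_FK fb; have FinvK := fb_FinvK fb.
pose c0 := Num.sqrt l1 / Num.sqrt l2; pose c := real_complex R c0.
have c00 : 0 < c0 by rewrite divr_gt0 // sqrtr_gt0.
have c_gt0 : 0 < c by rewrite ltcR.
have c_real : c^* = c by apply/CrealP; rewrite gtr0_real.
have l2_gt0 : 0 < real_complex R l2 by rewrite ltcR.
(* This balance of the gauge constants turns the Plancherel identity into isometry of the string
   transform for [t]. *)
have c2 : real_complex R l2 * (c * c) = real_complex R l1.
  rewrite -!realcM; congr (real_complex R _).
  rewrite -expr2 /c0 expr_div_n !sqr_sqrtr ?(ltW l10) ?(ltW l20) //.
  by rewrite mulrC divfK // gt_eqF.
have Fs a : string_fourier delta E e1 e2 (phi a) = psi (c *: F a) by rewrite Fpsi.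
have inP a : relcomm N M1 (phi a) by rewrite -(si_range iphi); exists a.
have inQ b : relcomm M M2 (psi b) by rewrite -(si_range ipsi); exists b.
have onP u : relcomm N M1 u -> exists a, u = phi a.
  by rewrite -(si_range iphi) => -[a _ <-]; exists a.
have onQ u : relcomm M M2 u -> exists b, u = psi b.
  by rewrite -(si_range ipsi) => -[b _ <-]; exists b.
have iso u v v' w' : relcomm N M1 u -> relcomm N M1 v -> adjoint v v' ->
    adjoint (string_fourier delta E e1 e2 v) w' ->
    t (w' \o string_fourier delta E e1 e2 u) = t (v' \o u).
  move=> /onP[a ->] /onP[b ->] av; rewrite !Fs => aw.
  rewrite (adjoint_uniq av (si_star iphi b)) (adjoint_uniq aw (si_star ipsi _)).
  rewrite -(si_mul iphi) -(si_mul ipsi) tphi tpsi starZ c_real.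
  by rewrite -scalerAl -scalerAr scalerA linearZ /= (fb_plancherel fb) mulrA c2.
have onto w : relcomm M M2 w -> exists2 u, relcomm N M1 u &
    string_fourier delta E e1 e2 u = w.
  move=> /onQ[b ->]; exists (phi (Finv (c^-1 *: b))) => //.
  by rewrite Fs FinvK scalerA divff ?scale1r // gt_eqF.
have [_ _ [K [rho [Om [iM2 gM1 pe2 dM2]]]]] := jt_basic2 jt.
apply: (cpositive_trace (fb_tau fb) sz) => w.
(* Half of the gauge factor goes into each side of [star b * b]. *)
pose g : R[i] := sqrtC c.
have g_real : g^* = g by apply/CrealP; rewrite ger0_real // sqrtC_ge0 ltW.
have gg : g * g = c by rewrite -expr2 sqrtCK.
have [r yr] := py; have [s xs] := px.
have scale b : c *: (star b * b) = star (g *: b) * (g *: b).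
  by rewrite starZ g_real -scalerAl -scalerAr scalerA gg.
have FU : string_fourier delta E e1 e2 (phi (Finv y)) =
    psi (star (g *: r)) \o psi (g *: r).
  by rewrite Fs FinvK yr scale (si_mul ipsi).
have FV : string_fourier delta E e1 e2 (phi (star (Finv x))) =
    psi (star (g *: rot F Finv s)) \o psi (g *: rot F Finv s).
  rewrite Fs -[F _]/(rot F Finv x) xs (rotM fb) (rot_star fb) scale.
  by rewrite (si_mul ipsi).
(* [convB] reverses the factors: [y] supplies the first one, and [x] the second, whose adjoint has
   the transform [c *: rot F Finv x]. *)
have := schur_trace_ge0 jt abel hE iso onto iM2 gM1 pe2 dM2 (inP (Finv y)) (inP (Finv x))
  (si_star iphi (Finv x)) (inQ (g *: r)) (inQ (g *: rot F Finv s))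
  (si_star ipsi _) (si_star ipsi _) FU FV (inQ w) (si_star ipsi w).
rewrite -(si_mul iphi) Fs -/z -(si_mul ipsi) -(si_mul ipsi) tpsi.
by rewrite -scalerAl -scalerAr linearZ /= !pmulr_rge0 //.
Qed.
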